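(* Let $q(y,z|x)$ be a discrete memoryless broadcast channel with finite alphabets. Let $r(u,v,w)$ be a pmf on finite sets $\mathcal U\times\mathcal V\times\mathcal W$ and $r(x|u_1,v_1,w_1,u_2,v_2,w_2)$ a conditional pmf on $\mathcal X$. Define $\tilde r(x|u,v,w)=\sum_{u',v',w'}r(x|u',v',w',u,v,w)\,r(u',v',w')$, and let $(U_1,V_1,W_1,U_2,V_2,W_2,X_1,X_2,Y_1,Y_2,Z_1,Z_2)$ have joint pmf $$r(u_1,v_1,w_1)\,r(u_2,v_2,w_2)\,r(x_2|u_1,v_1,w_1,u_2,v_2,w_2)\,q(y_2,z_2|x_2)\,\tilde r(x_1|u_1,v_1,w_1)\,q(y_1,z_1|x_1).$$ Then every rate triple $(R_0,R_1,R_2)$ with $R_0,R_1,R_2\ge0$ and $R_0+R_1<I(U_2W_2;Y_1Y_2U_1W_1)$, $R_0+R_2<I(V_2W_2;Z_1Z_2V_1W_1)$, $R_0+R_1+R_2<I(V_2;Z_1Z_2V_1W_1|W_2)+I(U_2W_2;Y_1Y_2U_1W_1)-I(U_2;V_2|W_2)$, $R_0+R_1+R_2<I(U_2;Y_1Y_2U_1W_1|W_2)+I(V_2W_2;Z_1Z_2V_1W_1)-I(U_2;V_2|W_2)$, $2R_0+R_1+R_2<I(U_2W_2;Y_1Y_2U_1W_1)+I(V_2W_2;Z_1Z_2V_1W_1)-I(U_2;V_2|W_2)$ is achievable for the broadcast channel $q$.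
   Context: A two-receiver discrete memoryless broadcast channel has finite alphabets $\mathcal X,\mathcal Y,\mathcal Z$ and transition law $q(y,z|x)$, used memorylessly. A rate triple $(R_0,R_1,R_2)$ is achievable if for every $\epsilon>0$ and all sufficiently large $n$ there is a length-$n$ code sending a common message of rate $R_0$ to both receivers and private messages of rates $R_1$ to receiver $Y$ and $R_2$ to receiver $Z$ with average error probability at most $\epsilon$ (equivalently, the triple lies in the capacity region, the closure of the achievable set). *)

(* Defs.v *)
(* Rates and informations are both measured in nats (consistent units). *)
From HB Require Import structures.
From mathcomp Require Import all_boot all_order all_algebra.
From mathcomp Require Import all_classical all_reals all_analysis.
Set Implicit Arguments. Unset Strict Implicit. Unset Printing Implicit Defensive.
Import Order.TTheory GRing.Theory Num.Theory.
Local Open Scope ring_scope.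

Section BC.
Variable R : realType.

Definition is_pmf (T : finType) (p : T -> R) : Prop :=
  (forall t, 0 <= p t) /\ \sum_(t : T) p t = 1.

Definition entropy (T S : finType) (P : T -> R) (f : T -> S) : R :=
  - \sum_(s : S) ((\sum_(t : T | f t == s) P t) * ln (\sum_(t : T | f t == s) P t)).

Definition minfo (T A B : finType) (P : T -> R) (a : T -> A) (b : T -> B) : R :=
  entropy P a + entropy P b - entropy P (fun t => (a t, b t)).

Definition cminfo (T A B C : finType) (P : T -> R)
    (a : T -> A) (b : T -> B) (c : T -> C) : R :=
  entropy P (fun t => (a t, c t)) + entropy P (fun t => (b t, c t))
  - entropy P (fun t => (a t, b t, c t)) - entropy P c.

Definition is_channel (X Y Z : finType) (q : X -> Y -> Z -> R) : Prop :=
  forall x, is_pmf (fun yz : Y * Z => q x yz.1 yz.2).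

Definition msg_size (n : nat) (Rt : R) : nat := absz (Num.ceil (expR (n%:R * Rt))).

(* average error probability of a length-n code for the broadcast channel:
   encoder enc (common, private-1, private-2) -> X^n,
   decoder d1 : Y^n -> (common, private-1), decoder d2 : Z^n -> (common, private-2) *)
Definition avg_err (X Y Z : finType) (q : X -> Y -> Z -> R) (n k0 k1 k2 : nat)
    (enc : 'I_k0 * 'I_k1 * 'I_k2 -> {ffun 'I_n -> X})
    (d1 : {ffun 'I_n -> Y} -> 'I_k0 * 'I_k1)
    (d2 : {ffun 'I_n -> Z} -> 'I_k0 * 'I_k2) : R :=
  ((k0 * k1 * k2)%N%:R)^-1 *
  \sum_(m : 'I_k0 * 'I_k1 * 'I_k2)
   \sum_(y : {ffun 'I_n -> Y}) \sum_(z : {ffun 'I_n -> Z})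
     (\prod_(i < n) q (enc m i) (y i) (z i)) *
     ((d1 y != (m.1.1, m.1.2)) || (d2 z != (m.1.1, m.2)))%:R.

Definition achievable (X Y Z : finType) (q : X -> Y -> Z -> R) (R0 R1 R2 : R) : Prop :=
  forall eps : R, 0 < eps -> exists N : nat, forall n : nat, (N <= n)%N ->
    exists enc, exists d1, exists d2,
      @avg_err X Y Z q n (msg_size n R0) (msg_size n R1) (msg_size n R2) enc d1 d2 <= eps.

Definition sample (U V W X Y Z : finType) : finType :=
  ((U * V * W) * (U * V * W) * (X * X) * (Y * Y) * (Z * Z))%type.

Section Vars.
Variables U V W X Y Z : finType.
Definition sU1 (t : sample U V W X Y Z) : U := t.1.1.1.1.1.1.
Definition sV1 (t : sample U V W X Y Z) : V := t.1.1.1.1.1.2.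
Definition sW1 (t : sample U V W X Y Z) : W := t.1.1.1.1.2.
Definition sU2 (t : sample U V W X Y Z) : U := t.1.1.1.2.1.1.
Definition sV2 (t : sample U V W X Y Z) : V := t.1.1.1.2.1.2.
Definition sW2 (t : sample U V W X Y Z) : W := t.1.1.1.2.2.
Definition sX1 (t : sample U V W X Y Z) : X := t.1.1.2.1.
Definition sX2 (t : sample U V W X Y Z) : X := t.1.1.2.2.
Definition sY1 (t : sample U V W X Y Z) : Y := t.1.2.1.
Definition sY2 (t : sample U V W X Y Z) : Y := t.1.2.2.
Definition sZ1 (t : sample U V W X Y Z) : Z := t.2.1.
Definition sZ2 (t : sample U V W X Y Z) : Z := t.2.2.

Definition rtilde (r3 : U -> V -> W -> R) (rx : U -> V -> W -> U -> V -> W -> X -> R)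
    (u : U) (v : V) (w : W) (x : X) : R :=
  \sum_(a : U * V * W) rx a.1.1 a.1.2 a.2 u v w x * r3 a.1.1 a.1.2 a.2.

Definition joint (q : X -> Y -> Z -> R) (r3 : U -> V -> W -> R)
    (rx : U -> V -> W -> U -> V -> W -> X -> R) (t : sample U V W X Y Z) : R :=
  r3 (sU1 t) (sV1 t) (sW1 t) * r3 (sU2 t) (sV2 t) (sW2 t)
  * rx (sU1 t) (sV1 t) (sW1 t) (sU2 t) (sV2 t) (sW2 t) (sX2 t)
  * q (sX2 t) (sY2 t) (sZ2 t)
  * rtilde r3 rx (sU1 t) (sV1 t) (sW1 t) (sX1 t)
  * q (sX1 t) (sY1 t) (sZ1 t).
End Vars.
End BC.

(* Main.v *)
(* Random coding over blocks of n = k + 1 channel uses with a source s_0, ..., s_{k+1}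
   drawn i.i.d. from r(u,v,w) and x_i drawn from r(. | s_i, s_{i+1}).  With this memory the
   triple (s_{j+2}; y_j, y_{j+1}, s_{j+1}) has the law P of the theorem, so the product over
   j of the single-letter information densities grows like exp(k I) on the transmitted
   codeword (a law of large numbers for functions of a sliding window), while for an
   independent codeword its mean telescopes to at most 1, integrating out the letters from
   the last one backwards.

   These densities feed a one-shot version of Marton's coding scheme with cloud centers w
   and satellites u, v.  The encoder picks the satellite pair (l1, l2) with probability
   proportional to the density rho of (u, v) given w, and the decoders pick an index with
   probability proportional to the number of its codewords passing a threshold test.  The
   bound 1/(pqr) >= 4 - p - q - r linearizes the probability of correct decoding, so that
   averaging over the codebook involves only pairs of codewords and no covering lemma.  By
   multilinearity the stochastic coders can be made deterministic.  Rate splitting and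
   Fourier-Motzkin elimination then give the stated region. *)
Require Import Defs.
From HB Require Import structures.
From mathcomp Require Import all_boot all_order all_algebra.
From mathcomp Require Import all_classical all_reals all_analysis.
From mathcomp Require Import ring lra zify.
Set Implicit Arguments. Unset Strict Implicit. Unset Printing Implicit Defensive.
Import Order.TTheory GRing.Theory Num.Theory.
Local Open Scope ring_scope.

(** * Expectations under product laws on finite function spaces *)

Section ProductExpectation.
Variables (R : realType) (I A : finType).
Implicit Types (P : I -> A -> R) (f : {ffun I -> A}) (g : {ffun I -> A} -> R).

(** The law [P i] may vary with the coordinate: given the cloud centers, satellite letters are
    independent but not identically distributed. *)
Definition prodE P g : R := \sum_(f : {ffun I -> A}) (\prod_i P i (f i)) * g f.

Definition upd f i a : {ffun I -> A} := [ffun j => if j == i then a else f j].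

Definition mix (B : pred I) f f' : {ffun I -> A} := [ffun i => if B i then f i else f' i].

Definition depends_on (B : pred I) g : Prop :=
  forall f f', (forall i, B i -> f i = f' i) -> g f = g f'.

Lemma eq_prodE P g h : g =1 h -> prodE P g = prodE P h.
Proof. by move=> e; apply: eq_bigr => f _; rewrite e. Qed.

Lemma prodE_sum (J : finType) P (G : J -> {ffun I -> A} -> R) :
  prodE P (fun f => \sum_j G j f) = \sum_j prodE P (G j).
Proof. by rewrite /prodE exchange_big; apply: eq_bigr => f _; rewrite mulr_sumr. Qed.

Lemma prodEZ P c g : prodE P (fun f => c * g f) = c * prodE P g.
Proof. by rewrite /prodE mulr_sumr; apply: eq_bigr => f _; rewrite mulrCA. Qed.

Lemma prodED P g h : prodE P (fun f => g f + h f) = prodE P g + prodE P h.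
Proof. by rewrite /prodE -big_split; apply: eq_bigr => f _; rewrite mulrDr. Qed.

Lemma le_prodE P g h : (forall i a, 0 <= P i a) -> (forall f, g f <= h f) ->
  prodE P g <= prodE P h.
Proof.
move=> P0 gh; apply: ler_sum => f _; apply: ler_wpM2l => //.
by apply: prodr_ge0.
Qed.


(** Logarithms of densities are meaningful only where the law is positive, so comparisons must be
    restricted to the support. *)
Lemma le_prodE_supp P g h : (forall i a, 0 <= P i a) ->
  (forall f, (forall i, 0 < P i (f i)) -> g f <= h f) ->
  prodE P g <= prodE P h.
Proof.
move=> P0 gh; apply: ler_sum => f _.
have [fP|/forallPn[i]] := boolP [forall i, 0 < P i (f i)].
  by apply: ler_wpM2l; [apply: prodr_ge0|apply: gh => i; apply: (forallP fP)].
rewrite -leNgt => Pi; have /eqP Pi0 : P i (f i) == 0 by rewrite eq_le Pi P0.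
by rewrite (bigD1 i)//= Pi0 !mul0r.
Qed.

Lemma prodE_cst P c : (forall i, is_pmf (P i)) -> prodE P (fun=> c) = c.
Proof.
move=> hP; rewrite /prodE -mulr_suml -(bigA_distr_bigA P).
by rewrite big1 ?mul1r// => i _; case: (hP i).
Qed.

(** Resampling one coordinate independently preserves the law: the involution [sw] exchanges the
    letter [f i] with the fresh one and keeps the joint weight. *)
Lemma prodE_upd P g i : is_pmf (P i) ->
  prodE P g = prodE P (fun f => \sum_a P i a * g (upd f i a)).
Proof.
case=> _ P1.
pose sw (x : {ffun I -> A} * A) := (upd x.1 i x.2, x.1 i).
have swK : involutive sw.
  move=> [f a]; rewrite /sw /=; congr (_, _); last by rewrite ffunE eqxx.
  by apply/ffunP => j; rewrite !ffunE; case: eqP => // ->.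
transitivity (\sum_(x : {ffun I -> A} * A)
    (\prod_j P j (x.1 j)) * P i x.2 * g x.1).
  rewrite /prodE -(pair_bigA _ (fun f a => (\prod_j P j (f j)) * P i a * g f)) /=.
  apply: eq_bigr => f _; rewrite -mulr_suml -mulr_sumr P1 mulr1 //.
rewrite (reindex_inj (inv_inj swK)) /=.
rewrite /prodE -(pair_bigA _ (fun f a => (\prod_j P j (upd f i a j)) * P i (f i) * g (upd f i a))) /=.
apply: eq_bigr => f _; rewrite mulr_sumr; apply: eq_bigr => a _.
rewrite mulrA; congr (_ * _).
rewrite (bigD1 i)//= [in RHS](bigD1 i)//= ffunE eqxx.
rewrite (eq_bigr (fun j => P j (f j))); first by ring.
by move=> j /negbTE ji; rewrite ffunE ji.
Qed.

(** Take two independent copies and exchange their coordinates outside [B]. Afterwards [g] reads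
    only the first copy and [h] only the second. *)
Lemma prodE_indep P g h (B : pred I) : (forall i, is_pmf (P i)) ->
  depends_on B g -> depends_on (predC B) h ->
  prodE P (fun f => g f * h f) = prodE P g * prodE P h.
Proof.
move=> hP gB hB.
pose sw (x : {ffun I -> A} * {ffun I -> A}) := (mix B x.1 x.2, mix B x.2 x.1).
have swK : involutive sw.
  move=> [f f']; rewrite /sw /=; congr (_, _);
    by apply/ffunP => j; rewrite !ffunE; case: (B j).
transitivity (\sum_(x : {ffun I -> A} * {ffun I -> A})
    (\prod_j P j (x.1 j)) * (\prod_j P j (x.2 j)) * (g x.1 * h x.1)).
  rewrite /prodE -(pair_bigA _ (fun f f' =>
    (\prod_j P j (f j)) * (\prod_j P j (f' j)) * (g f * h f))) /=.
  apply: eq_bigr => f _; rewrite -mulr_suml -mulr_sumr.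
  have := prodE_cst 1 hP; rewrite /prodE -mulr_suml mulr1 => ->.
  by rewrite mulr1.
rewrite (reindex_inj (inv_inj swK)) /=.
rewrite /prodE big_distrl /=.
under [RHS]eq_bigr do rewrite big_distrr.
rewrite -(pair_bigA _ (fun f f' => (\prod_j P j (mix B f f' j)) * (\prod_j P j (mix B f' f j)) *
   (g (mix B f f') * h (mix B f f')))) /=.
apply: eq_bigr => f _; apply: eq_bigr => f' _.
rewrite (gB (mix B f f') f); last by move=> i Bi; rewrite ffunE Bi.
rewrite (hB (mix B f f') f'); last by move=> i /negbTE Bi; rewrite ffunE Bi.
rewrite -big_split /=.
rewrite (eq_bigr (fun j => P j (f j) * P j (f' j))).
  by rewrite big_split /=; ring.
by move=> j _; rewrite !ffunE; case: ifP => _ //; rewrite mulrC.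
Qed.

Lemma prodE_marg1 P i (g : A -> R) : (forall i, is_pmf (P i)) ->
  prodE P (fun f => g (f i)) = \sum_a P i a * g a.
Proof.
move=> hP; rewrite (prodE_upd _ (hP i)).
under eq_prodE do under eq_bigr do rewrite ffunE eqxx.
by rewrite prodE_cst.
Qed.

Lemma prodE_marg2 P i j (g : A -> A -> R) : (forall i, is_pmf (P i)) -> i != j ->
  prodE P (fun f => g (f i) (f j)) = \sum_a \sum_b P i a * P j b * g a b.
Proof.
move=> hP ij; rewrite (prodE_upd _ (hP j)).
under eq_prodE do under eq_bigr do rewrite !ffunE eqxx (negbTE ij).
rewrite (prodE_marg1 i (fun a => \sum_b P j b * g a b) hP).
by apply: eq_bigr => a _; rewrite mulr_sumr; apply: eq_bigr => b _; rewrite mulrA.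
Qed.

Lemma prodE_marg3 P i j k (g : A -> A -> A -> R) : (forall i, is_pmf (P i)) ->
  i != j -> i != k -> j != k ->
  prodE P (fun f => g (f i) (f j) (f k)) =
  \sum_a \sum_b \sum_c P i a * P j b * P k c * g a b c.
Proof.
move=> hP ij ik jk; rewrite (prodE_upd _ (hP k)).
under eq_prodE do under eq_bigr do rewrite !ffunE eqxx (negbTE ik) (negbTE jk).
rewrite (prodE_marg2 (fun a b => \sum_c P k c * g a b c) hP ij).
apply: eq_bigr => a _; apply: eq_bigr => b _; rewrite mulr_sumr.
by apply: eq_bigr => c _; rewrite !mulrA.
Qed.

(** One step of integrating out letters: [g] ignores coordinate [i], so [h] is averaged over that
    coordinate first. *)
Lemma prodE_mul_le P i c (g h : {ffun I -> A} -> R) :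
  (forall i, is_pmf (P i)) -> (forall f, 0 <= g f) ->
  (forall f a, g (upd f i a) = g f) ->
  (forall f, \sum_a P i a * h (upd f i a) <= c) ->
  prodE P (fun f => g f * h f) <= c * prodE P g.
Proof.
move=> hP g0 gi hc; rewrite (prodE_upd _ (hP i)) -prodEZ.
apply: le_prodE => [j a|f]; first by case: (hP j).
under eq_bigr do rewrite gi mulrCA.
by rewrite -mulr_sumr mulrC ler_wpM2r.
Qed.

End ProductExpectation.

(** * Mean of a product of factors chained along consecutive letters *)

Section Telescoping.
Variables (R : realType) (A : finType) (k : nat).
Variables (P : 'I_k.+2 -> A -> R) (B : nat -> A -> A -> R).
Hypothesis hP : forall i, is_pmf (P i).
Hypothesis B0 : forall j a b, 0 <= B j a b.
Hypothesis B1 : forall j a, (j < k)%N -> \sum_b P (inord j.+2) b * B j a b <= 1.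

Definition chain (m : nat) (f : {ffun 'I_k.+2 -> A}) : R :=
  \prod_(0 <= j < m) B j (f (inord j.+1)) (f (inord j.+2)).

Lemma inord_eq (a b : nat) : (a < k.+2)%N -> (b < k.+2)%N ->
  (inord a == inord b :> 'I_k.+2) = (a == b).
Proof. by move=> ha hb; rewrite -val_eqE /= !inordK. Qed.

(** Among the factors of [chain m.+1], only the last one contains letter [m.+2]. Averaging over that
    letter removes this factor at the cost of a constant at most 1, whatever the preceding letter
    is. *)
Lemma prodE_chain_le1 m : (m <= k)%N -> prodE P (chain m) <= 1.
Proof.
elim: m => [_|m IH mk].
  rewrite (@eq_prodE _ _ _ _ _ (fun=> 1)) ?prodE_cst//.
  by move=> f; rewrite /chain big_nil.
have eqc : chain m.+1 =1
    (fun f => chain m f * B m (f (inord m.+1)) (f (inord m.+2))).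
  by move=> f; rewrite /chain big_nat_recr.
rewrite (eq_prodE _ eqc).
apply: le_trans (IH (ltnW mk)); rewrite -[leRHS]mul1r.
apply: (@prodE_mul_le _ _ _ _ (inord m.+2)) => //.
- by move=> f; apply: prodr_ge0.
- move=> f a; apply: eq_big_nat => j /andP[_ jm].
  have e1 : (j.+1 == m.+2) = false by lia.
  have e2 : (j.+2 == m.+2) = false by lia.
  by rewrite !ffunE !inord_eq ?e1 ?e2//; lia.
- move=> f.
  have e : (inord m.+1 == inord m.+2 :> 'I_k.+2) = false by rewrite inord_eq; lia.
  under eq_bigr do rewrite !ffunE eqxx e.
  exact: B1.
Qed.

End Telescoping.

(** * Weak law of large numbers for sliding windows of a source path and its outputs *)

Section LLN.
Variables (R : realType) (S T : finType) (k : nat).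
Variables (r : S -> R) (kap : S -> S -> T -> R).
Hypothesis hr : is_pmf r.
Hypothesis hkap : forall a b, is_pmf (kap a b).

Definition stepP (s : {ffun 'I_k.+2 -> S}) (i : 'I_k.+1) : T -> R :=
  kap (s (inord i)) (s (inord i.+1)).

Definition pathE (g : {ffun 'I_k.+2 -> S} -> {ffun 'I_k.+1 -> T} -> R) : R :=
  prodE (fun=> r) (fun s => prodE (stepP s) (g s)).

(** The letters [a], [b], [c] stand for [s_j], [s_{j+1}], [s_{j+2}]. Although [f] does not read [a],
    the law of the output [x] depends on it. *)
Definition windowE (f : S -> S -> T -> T -> R) : R :=
  \sum_a \sum_b \sum_c r a * r b * r c *
    \sum_x \sum_y kap a b x * kap b c y * f b c x y.

Definition window (f : S -> S -> T -> T -> R) (j : nat)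
    (s : {ffun 'I_k.+2 -> S}) (t : {ffun 'I_k.+1 -> T}) : R :=
  f (s (inord j.+1)) (s (inord j.+2)) (t (inord j)) (t (inord j.+1)).

Lemma stepP_pmf s i : is_pmf (stepP s i). Proof. exact: hkap. Qed.

Lemma le_pathE g h : (forall s t, g s t <= h s t) -> pathE g <= pathE h.
Proof.
move=> gh; apply: le_prodE => [i a|s]; first by case: hr.
apply: le_prodE => [i a|t]; last exact: gh.
by case: (stepP_pmf s i).
Qed.

Lemma eq_pathE g h : (forall s t, g s t = h s t) -> pathE g = pathE h.
Proof. by move=> gh; apply: eq_prodE => s; apply: eq_prodE => t; apply: gh. Qed.

Lemma pathE_sum (J : finType) (G : J -> _ -> _ -> R) :
  pathE (fun s t => \sum_j G j s t) = \sum_j pathE (G j).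
Proof.
by rewrite /pathE -prodE_sum; apply: eq_prodE => s; rewrite -prodE_sum.
Qed.

Lemma pathE_cst c : pathE (fun _ _ => c) = c.
Proof.
rewrite /pathE (@eq_prodE _ _ _ _ _ (fun=> c)) ?prodE_cst// => s.
exact: prodE_cst (stepP_pmf s).
Qed.

Lemma pathEZ c g : pathE (fun s t => c * g s t) = c * pathE g.
Proof. by rewrite /pathE -prodEZ; apply: eq_prodE => s; rewrite prodEZ. Qed.

Lemma pathED g h : pathE (fun s t => g s t + h s t) = pathE g + pathE h.
Proof. by rewrite /pathE -prodED; apply: eq_prodE => s; rewrite prodED. Qed.

Let wmean (f : S -> S -> T -> T -> R) a b c :=
  \sum_x \sum_y kap a b x * kap b c y * f b c x y.

Lemma prodE_window f (j : nat) s : (j < k)%N ->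
  prodE (stepP s) (window f j s) =
  wmean f (s (inord j)) (s (inord j.+1)) (s (inord j.+2)).
Proof.
move=> jk.
have ne : (inord j : 'I_k.+1) != inord j.+1.
  by rewrite -val_eqE /= !inordK; lia.
rewrite /window (prodE_marg2 (fun x y => f _ _ x y) (stepP_pmf s) ne).
by rewrite /wmean /stepP !inordK//; lia.
Qed.

Lemma pathE_window f (j : nat) : (j < k)%N -> pathE (window f j) = windowE f.
Proof.
move=> jk; rewrite /pathE (eq_prodE _ (fun s => prodE_window f s jk)).
by rewrite (prodE_marg3 (wmean f)) => // [||]; rewrite inord_eq; lia.
Qed.

(** Such windows share neither outputs nor source letters that drive those outputs. Independence is
    used twice: for the outputs given the source, then for the conditional means as functions of the
    source. *)
Lemma pathE_window_far f (i j : nat) : windowE f = 0 -> (i.+2 < j)%N -> (j < k)%N ->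
  pathE (fun s t => window f i s t * window f j s t) = 0.
Proof.
move=> f0 ij jk.
have ik : (i < k)%N by lia.
transitivity (prodE (fun=> r) (fun s : {ffun 'I_k.+2 -> S} =>
    wmean f (s (inord i)) (s (inord i.+1)) (s (inord i.+2)) *
    wmean f (s (inord j)) (s (inord j.+1)) (s (inord j.+2)))).
  apply: eq_prodE => s; rewrite -(prodE_window f s ik) -(prodE_window f s jk).
  apply: (@prodE_indep _ _ _ _ _ _ (fun l : 'I_k.+1 => l <= i.+1)%N).
  - exact: stepP_pmf.
  - by move=> t t' e; rewrite /window !e// inordK; lia.
  - by move=> t t' e; rewrite /window !e//= inordK; lia.
rewrite (@prodE_indep _ _ _ _ (fun s => wmean f (s _) (s _) (s _))
    (fun s => wmean f (s _) (s _) (s _)) (fun l : 'I_k.+2 => l <= i.+2)%N)//.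
- have := pathE_window f ik; rewrite /pathE (eq_prodE _ (fun s => prodE_window f s ik)) => ->.
  by rewrite f0 mul0r.
- by move=> t t' e; rewrite !e// inordK; lia.
- by move=> t t' e; rewrite !e//= inordK; lia.
Qed.

Lemma le_pathE_supp g h :
  (forall (s : {ffun 'I_k.+2 -> S}) (t : {ffun 'I_k.+1 -> T}),
    (forall i, 0 < r (s i)) -> (forall i, 0 < stepP s i (t i)) ->
    g s t <= h s t) -> pathE g <= pathE h.
Proof.
move=> gh; apply: le_prodE_supp => [i a|s rs]; first by case: hr.
apply: le_prodE_supp => [i a|t ts]; first by case: (stepP_pmf s i).
exact: gh.
Qed.

Lemma card_near (i : nat) :
  (\sum_(j < k) ((i <= j + 2) && (j <= i + 2)) <= 5)%N.
Proof.
rewrite -(big_mkord xpredT (fun j => nat_of_bool ((i <= j + 2) && (j <= i + 2)))%N).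
rewrite -big_mkcond /= sum1_count /index_iota subn0 -size_filter.
(* Truncated subtraction may repeat entries of this list; only its length 5 counts. *)
apply: (@uniq_leq_size _ _ [:: i - 2; i - 1; i; i + 1; i + 2]%N).
  by rewrite filter_uniq// iota_uniq.
by move=> j; rewrite mem_filter !inE => /andP[]; lia.
Qed.

(** Expanding the square leaves, for each [i], at most five indices [j] whose window is correlated
    with window [i], so the second moment is linear in [k]. *)
Lemma pathE_window_sq f (B : R) : windowE f = 0 -> (forall a b x y, `|f a b x y| <= B) ->
  pathE (fun s t => (\sum_(j < k) window f j s t) ^+ 2) <= 5 * k%:R * B ^+ 2.
Proof.
move=> f0 fB.
have prodB a b x y a' b' x' y' : f a b x y * f a' b' x' y' <= B ^+ 2.
  apply: le_trans (ler_norm _) _; rewrite normrM expr2.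
  by apply: ler_pM.
have -> : pathE (fun s t => (\sum_(j < k) window f j s t) ^+ 2) =
    \sum_(i < k) \sum_(j < k) pathE (fun s t => window f i s t * window f j s t).
  under [RHS]eq_bigr do rewrite -pathE_sum.
  rewrite -pathE_sum; apply: eq_pathE => s t; rewrite expr2 big_distrl /=.
  by apply: eq_bigr => i _; rewrite mulr_sumr.
have near (i j : 'I_k) : pathE (fun s t => window f i s t * window f j s t) <=
    ((i <= j + 2) && (j <= i + 2))%N%:R * B ^+ 2.
  case: (boolP ((i <= j + 2) && (j <= i + 2))%N) => [_|].
    by rewrite mul1r -[leRHS]pathE_cst; apply: le_pathE => s t; apply: prodB.
  rewrite mul0r negb_and -!ltnNge => /orP[ji|ij].
    rewrite (@eq_pathE _ (fun s t => window f j s t * window f i s t)).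
      by rewrite pathE_window_far//; lia.
    by move=> s t; rewrite mulrC.
  by rewrite pathE_window_far//; lia.
apply: (@le_trans _ _ (\sum_(i < k) 5 * B ^+ 2)); last first.
  by rewrite sumr_const card_ord -mulr_natl; lra.
apply: ler_sum => i _; apply: le_trans (ler_sum _ (fun j _ => near i j)) _.
rewrite -mulr_suml ler_wpM2r ?sqr_ge0// -natr_sum ler_nat.
exact: card_near.
Qed.

(** Chebyshev's inequality with this second moment. *)
Lemma window_lln f (B d : R) : (0 < k)%N -> 0 < d -> windowE f = 0 ->
  (forall a b x y, `|f a b x y| <= B) ->
  pathE (fun s t => (k%:R * d <= `|\sum_(j < k) window f j s t|)%R%:R)
    <= 5 * B ^+ 2 / d ^+ 2 / k%:R.
Proof.
move=> k0 d0 f0 fB.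
have kR : 0 < k%:R :> R by rewrite ltr0n.
have kd : 0 < (k%:R * d) ^+ 2 by rewrite exprn_gt0// mulr_gt0.
apply: (@le_trans _ _ (pathE (fun s t => ((k%:R * d) ^+ 2)^-1 * (\sum_(j < k) window f j s t) ^+ 2))).
  apply: le_pathE => s t; case: (boolP (k%:R * d <= `|_|)) => [h|_]; last first.
    by rewrite /= mulr0n mulr_ge0 ?sqr_ge0// invr_ge0 ltW.
  rewrite /= mulr1n mulrC ler_pdivlMr// mul1r -[leRHS]real_normK ?num_real// ler_sqr//.
  by rewrite nnegrE mulr_ge0// ltW.
rewrite pathEZ mulrC ler_pdivrMr//.
apply: le_trans (pathE_window_sq f0 fB) _.
rewrite (_ : _ * (k%:R * d) ^+ 2 = 5 * k%:R * B ^+ 2)//.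
by field; rewrite !gt_eqF.
Qed.

End LLN.

(** * Exponential growth rate of a product of densities along the path *)

Section DensityLLN.
Variables (R : realType) (S T : finType) (r : S -> R) (kap : S -> S -> T -> R).
Hypothesis hr : is_pmf r.
Hypothesis hkap : forall a b, is_pmf (kap a b).

Lemma windowEB f c : windowE r kap (fun a b x y => f a b x y - c) =
  windowE r kap f - c.
Proof.
have w1 : windowE r kap (fun _ _ _ _ => c) = c.
  have r1 := proj2 hr; have k1 a b := proj2 (hkap a b).
  have inner a b e : \sum_x \sum_y kap a b x * kap b e y * c = c.
    under eq_bigr do rewrite -mulr_suml -mulr_sumr k1 mulr1.
    by rewrite -mulr_suml k1 mul1r.
  rewrite /windowE.
  under eq_bigr do under eq_bigr do under eq_bigr do rewrite inner.
  under eq_bigr do under eq_bigr do rewrite -mulr_suml -mulr_sumr r1 mulr1.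
  under eq_bigr do rewrite -mulr_suml -mulr_sumr r1 mulr1.
  by rewrite -mulr_suml r1 mul1r.
rewrite -[in RHS]w1.
rewrite /windowE -sumrB; apply: eq_bigr => a _; rewrite -sumrB.
apply: eq_bigr => b _; rewrite -sumrB; apply: eq_bigr => e _.
rewrite -mulrBr -sumrB; congr (_ * _); apply: eq_bigr => x _; rewrite -sumrB.
by apply: eq_bigr => y _; rewrite mulrBr.
Qed.

(** The logarithm of the product is a sum of windows. The constant [C] depends on [D] and [d] but
    not on the block length. *)
Lemma density_tail (D : S -> S -> T -> T -> R) (d : R) : 0 < d ->
  (forall a b c x y, 0 < r a -> 0 < r b -> 0 < r c -> 0 < kap a b x ->
     0 < kap b c y -> 0 < D b c x y) ->
  exists C : R, 0 <= C /\ forall k, (0 < k)%N ->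
    pathE r kap (fun (s : {ffun 'I_k.+2 -> S}) t => (~~
      (expR (k%:R * (windowE r kap (fun a b x y => ln (D a b x y)) - d)) <=
       \prod_(j < k) window D j s t <=
       expR (k%:R * (windowE r kap (fun a b x y => ln (D a b x y)) + d)))%R)%:R)
    <= C / k%:R.
Proof.
move=> d0 Dpos; set m := windowE _ _ _.
pose f a b x y := ln (D a b x y) - m.
(* The alphabets are finite, so the sum of all absolute values is a uniform bound, including at
   points off the support. *)
pose B := \sum_(w : S * S * T * T) `|f w.1.1.1 w.1.1.2 w.1.2 w.2|.
have fB a b x y : `|f a b x y| <= B.
  by rewrite /B (bigD1 (a, b, x, y))//= lerDl sumr_ge0.
have f0 : windowE r kap f = 0 by rewrite windowEB subrr.
exists (5 * B ^+ 2 / d ^+ 2); split.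
  by rewrite mulr_ge0 ?invr_ge0 ?sqr_ge0// mulr_ge0 ?sqr_ge0.
move=> k k0; apply: le_trans (window_lln hr hkap k0 d0 f0 fB).
apply: le_pathE_supp => // s t rs ts.
have Dp (j : 'I_k) : 0 < window D j s t.
  have jk := ltn_ord j.
  have t1 := ts (inord j); have t2 := ts (inord j.+1).
  rewrite /stepP !inordK in t1 t2; try lia.
  exact: Dpos (rs _) (rs _) (rs _) t1 t2.
have -> : \prod_(j < k) window D j s t =
    expR (k%:R * m + \sum_(j < k) window f j s t).
  have -> : k%:R * m + \sum_(j < k) window f j s t =
      \sum_(j < k) ln (window D j s t).
    by rewrite /window /f sumrB sumr_const card_ord -[m *+ k]mulr_natl; lra.
  rewrite expR_sum; apply: eq_bigr => j _.
  by rewrite lnK// posrE; apply: Dp.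
rewrite !ler_expR ler_nat.
case: (leP (k%:R * d) `|_|) => [_|h]; first exact: leq_b1.
rewrite leqn0 eqb0 negbK.
by move: h; rewrite ltr_norml => /andP[h1 h2]; apply/andP; split; lra.
Qed.

End DensityLLN.

(** * Finite expectations, derandomization and an elementary inequality *)

Section FiniteExpectation.
Variable R : realType.
Implicit Types A B : finType.

Definition Ex A (p F : A -> R) : R := \sum_a p a * F a.

Lemma eq_Ex A (p F G : A -> R) : F =1 G -> Ex p F = Ex p G.
Proof. by move=> e; apply: eq_bigr => a _; rewrite e. Qed.

Lemma le_Ex A (p F G : A -> R) : (forall a, 0 <= p a) -> (forall a, F a <= G a) ->
  Ex p F <= Ex p G.
Proof. by move=> p0 FG; apply: ler_sum => a _; apply: ler_wpM2l. Qed.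

Lemma Ex_ge0 A (p F : A -> R) : (forall a, 0 <= p a) -> (forall a, 0 <= F a) ->
  0 <= Ex p F.
Proof. by move=> p0 F0; apply: sumr_ge0 => a _; apply: mulr_ge0. Qed.

Lemma ExZ A (p : A -> R) c F : Ex p (fun a => c * F a) = c * Ex p F.
Proof. by rewrite /Ex mulr_sumr; apply: eq_bigr => a _; rewrite mulrCA. Qed.

Lemma ExB A (p F G : A -> R) : Ex p (fun a => F a - G a) = Ex p F - Ex p G.
Proof. by rewrite /Ex -sumrB; apply: eq_bigr => a _; rewrite mulrBr. Qed.

Lemma Ex_cst A (p : A -> R) c : is_pmf p -> Ex p (fun=> c) = c.
Proof. by case=> _ p1; rewrite /Ex -mulr_suml p1 mul1r. Qed.

Lemma Ex_sum A (J : finType) (Q : pred J) (p : A -> R) (F : J -> A -> R) :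
  Ex p (fun a => \sum_(j | Q j) F j a) = \sum_(j | Q j) Ex p (F j).
Proof. by rewrite /Ex exchange_big; apply: eq_bigr => a _; rewrite mulr_sumr. Qed.

Lemma Ex_exchange A B (p : A -> R) (q : B -> R) F :
  Ex p (fun a => Ex q (F a)) = Ex q (fun b => Ex p (F^~ b)).
Proof.
rewrite /Ex; under eq_bigr do rewrite mulr_sumr; rewrite exchange_big /=.
by apply: eq_bigr => b _; rewrite mulr_sumr; apply: eq_bigr => a _; rewrite mulrCA.
Qed.

Lemma Ex_le_cst A (p F : A -> R) c : is_pmf p -> (forall a, F a <= c) -> Ex p F <= c.
Proof. by move=> hp Fc; rewrite -[leRHS](Ex_cst c hp); apply: le_Ex => //; case: hp. Qed.

Lemma exists_ge_Ex A (p F : A -> R) : is_pmf p -> exists a, Ex p F <= F a.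
Proof.
move=> hp; case: (pickP (fun _ : A => true)) => [a0 _|e]; last first.
  by case: hp => _; rewrite big_pred0// => /eqP; rewrite eq_sym oner_eq0.
exists [arg max_(a > a0) F a]%O; case: arg_maxP => // a _ ha.
by apply: Ex_le_cst => // b; apply: ha.
Qed.


Lemma sum_pair A B (F : A * B -> R) : \sum_x F x = \sum_a \sum_b F (a, b).
Proof. by rewrite pair_bigA; apply: eq_bigr => -[]. Qed.

(** A quantity linear in a kernel is maximized by a deterministic choice. Since [F] is nonnegative,
    kernels of total mass below 1 are allowed; [b0] only shows that [B] is inhabited. *)
Lemma derandomize A B (b0 : B) (K F : A -> B -> R) :
  (forall a b, 0 <= K a b) -> (forall a, \sum_b K a b <= 1) ->
  (forall a b, 0 <= F a b) ->
  exists f : A -> B, \sum_a \sum_b K a b * F a b <= \sum_a F a (f a).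
Proof.
move=> K0 K1 F0; exists (fun a => [arg max_(b > b0) F a b]%O).
apply: ler_sum => a _; case: arg_maxP => // b _ hb.
apply: (@le_trans _ _ (\sum_b' K a b' * F a b)).
  by apply: ler_sum => b' _; apply: ler_wpM2l => //; apply: hb.
by rewrite -mulr_suml -[leRHS]mul1r; apply: ler_wpM2r.
Qed.

(** Write the left factor as an exponential: [exp(-t) >= 1 - t] with [t = ln p + ln q + ln r], then
    [ln x <= x - 1] for each factor. *)
Lemma inv_mul3_ge (p q r : R) : 0 < p -> 0 < q -> 0 < r ->
  4 - p - q - r <= (p * q * r)^-1.
Proof.
move=> p0 q0 r0.
have lnle (x : R) : 0 < x -> ln x <= x - 1.
  move=> x0; have := expR_ge1Dx (ln x); rewrite lnK ?posrE//; lra.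
have -> : (p * q * r)^-1 = expR (- (ln p + ln q + ln r)).
  by rewrite expRN !expRD !lnK ?posrE.
apply: le_trans (expR_ge1Dx _).
have := lnle p p0; have := lnle q q0; have := lnle r r0; lra.
Qed.

Lemma prod_pmf (I A : finType) (P : I -> A -> R) : (forall i, is_pmf (P i)) ->
  is_pmf (fun f : {ffun I -> A} => \prod_i P i (f i)).
Proof.
move=> hP; split=> [f|]; first by apply: prodr_ge0 => i _; case: (hP i).
by have := prodE_cst 1 hP; rewrite /prodE -mulr_suml mulr1.
Qed.

Lemma Ex_marg1 (I A : finType) (P : I -> A -> R) i (g : A -> R) :
  (forall i, is_pmf (P i)) ->
  Ex (fun f : {ffun I -> A} => \prod_i P i (f i)) (fun f => g (f i)) = Ex (P i) g.
Proof. exact: prodE_marg1. Qed.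

Lemma Ex_marg2 (I A : finType) (P : I -> A -> R) i j (g : A -> A -> R) :
  (forall i, is_pmf (P i)) -> i != j ->
  Ex (fun f : {ffun I -> A} => \prod_i P i (f i)) (fun f => g (f i) (f j)) =
  Ex (P i) (fun a => Ex (P j) (g a)).
Proof.
move=> hP ij; have := prodE_marg2 g hP ij; rewrite /prodE /Ex => ->.
by apply: eq_bigr => a _; rewrite mulr_sumr; apply: eq_bigr => b _; rewrite mulrA.
Qed.

End FiniteExpectation.

(** * Random superposition codebooks: a cloud center with two families of satellites *)

Section Cloud.
Variables (R : realType) (U V W I J : finType).
Variables (pW : W -> R) (pU : W -> U -> R) (pV : W -> V -> R).
Hypothesis hW : is_pmf pW.
Hypothesis hU : forall w, is_pmf (pU w).
Hypothesis hV : forall w, is_pmf (pV w).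

Definition cloud : finType := (W * {ffun I -> U} * {ffun J -> V})%type.

(** Given the center, all satellites are independent. The dependence between [u] and [v] is created
    only by the encoder's choice of a pair. *)
Definition cloudP (c : cloud) : R :=
  pW c.1.1 * (\prod_i pU c.1.1 (c.1.2 i)) * \prod_j pV c.1.1 (c.2 j).

(** The reference law, under which [u] and [v] are conditionally independent given [w]; the wanted
    joint law has a density with respect to it. *)
Definition triE (F : W -> U -> V -> R) : R :=
  Ex pW (fun w => Ex (pU w) (fun u => Ex (pV w) (F w u))).

Let PU w (f : {ffun I -> U}) := \prod_i pU w (f i).
Let PV w (g : {ffun J -> V}) := \prod_j pV w (g j).

Lemma Ex_cloud (F : cloud -> R) :
  Ex cloudP F = Ex pW (fun w => Ex (PU w) (fun f => Ex (PV w) (fun g => F (w, f, g)))).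
Proof.
rewrite /Ex sum_pair sum_pair.
apply: eq_bigr => w _; rewrite mulr_sumr; apply: eq_bigr => f _.
rewrite !mulr_sumr; apply: eq_bigr => g _.
by rewrite /cloudP /= !mulrA.
Qed.

Lemma cloud_pmf : is_pmf cloudP.
Proof.
split=> [c|].
  by rewrite /cloudP !mulr_ge0// ?prodr_ge0// => *; case: (hW, hU c.1.1, hV c.1.1) => [[[? _] [? _]] [? _]].
transitivity (Ex cloudP (fun=> 1)); first by apply: eq_bigr => c _; rewrite mulr1.
rewrite Ex_cloud -[RHS](Ex_cst 1 hW); apply: eq_Ex => w.
rewrite -[RHS](Ex_cst 1 (prod_pmf (fun _ : I => hU w))); apply: eq_Ex => f.
by rewrite (Ex_cst 1 (prod_pmf (fun _ : J => hV w))).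
Qed.

Lemma le_triE F G : (forall w u v, F w u v <= G w u v) -> triE F <= triE G.
Proof.
move=> FG; apply: le_Ex => [|w]; first by case: hW.
apply: le_Ex => [|u]; first by case: (hU w).
by apply: le_Ex => [|v] //; case: (hV w).
Qed.

(** In this family of lemmas the two digits count the distinct [u] satellites and the distinct [v]
    satellites that are read. *)
Lemma cloud_marg11 F i j :
  Ex cloudP (fun c => F c.1.1 (c.1.2 i) (c.2 j)) = triE F.
Proof.
rewrite Ex_cloud; apply: eq_Ex => w /=.
rewrite (@eq_Ex _ _ _ _ (fun f : {ffun I -> U} => Ex (pV w) (F w (f i)))); last first.
  by move=> f; rewrite (Ex_marg1 j (F w (f i)) (fun=> hV w)).
exact: (Ex_marg1 i (fun u => Ex (pV w) (F w u)) (fun=> hU w)).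
Qed.

Lemma cloud_marg21 F i i' j : i != i' ->
  Ex cloudP (fun c => F c.1.1 (c.1.2 i) (c.2 j) (c.1.2 i')) =
  triE (fun w u v => Ex (pU w) (F w u v)).
Proof.
move=> ii; rewrite Ex_cloud; apply: eq_Ex => w /=.
rewrite (@eq_Ex _ _ _ _ (fun f : {ffun I -> U} => Ex (pV w) (fun v => F w (f i) v (f i')))); last first.
  by move=> f; rewrite (Ex_marg1 j (fun v => F w (f i) v (f i')) (fun=> hV w)).
rewrite (Ex_marg2 (fun u u' => Ex (pV w) (fun v => F w u v u')) (fun=> hU w) ii).
by apply: eq_Ex => u; rewrite Ex_exchange.
Qed.

Lemma cloud_marg12 F i j j' : j != j' ->
  Ex cloudP (fun c => F c.1.1 (c.1.2 i) (c.2 j) (c.2 j')) =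
  triE (fun w u v => Ex (pV w) (F w u v)).
Proof.
move=> jj; rewrite Ex_cloud; apply: eq_Ex => w /=.
rewrite (@eq_Ex _ _ _ _ (fun f : {ffun I -> U} => Ex (pV w) (fun v => Ex (pV w) (F w (f i) v)))); last first.
  by move=> f; rewrite (Ex_marg2 (fun v v' => F w (f i) v v') (fun=> hV w) jj).
exact: (Ex_marg1 i (fun u => Ex (pV w) (fun v => Ex (pV w) (F w u v))) (fun=> hU w)).
Qed.

Lemma cloud_marg22 F i i' j j' : i != i' -> j != j' ->
  Ex cloudP (fun c => F c.1.1 (c.1.2 i) (c.2 j) (c.1.2 i') (c.2 j')) =
  triE (fun w u v => Ex (pU w) (fun u' => Ex (pV w) (F w u v u'))).
Proof.
move=> ii jj; rewrite Ex_cloud; apply: eq_Ex => w /=.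
rewrite (@eq_Ex _ _ _ _ (fun f : {ffun I -> U} => Ex (pV w) (fun v => Ex (pV w) (F w (f i) v (f i'))))); last first.
  by move=> f; rewrite (Ex_marg2 (fun v v' => F w (f i) v (f i') v') (fun=> hV w) jj).
rewrite (Ex_marg2 (fun u u' => Ex (pV w) (fun v => Ex (pV w) (F w u v u'))) (fun=> hU w) ii).
by apply: eq_Ex => u; rewrite Ex_exchange.
Qed.

Lemma cloud_margU F i : Ex cloudP (fun c => F c.1.1 (c.1.2 i)) =
  Ex pW (fun w => Ex (pU w) (F w)).
Proof.
rewrite Ex_cloud; apply: eq_Ex => w /=.
rewrite (@eq_Ex _ _ _ _ (fun f : {ffun I -> U} => F w (f i))); last first.
  by move=> f; rewrite (Ex_cst _ (prod_pmf (fun=> hV w))).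
exact: (Ex_marg1 i (F w) (fun=> hU w)).
Qed.

Lemma cloud_margV F j : Ex cloudP (fun c => F c.1.1 (c.2 j)) =
  Ex pW (fun w => Ex (pV w) (F w)).
Proof.
rewrite Ex_cloud; apply: eq_Ex => w /=.
rewrite (@eq_Ex _ _ _ _ (fun f : {ffun I -> U} => Ex (pV w) (F w))); last first.
  by move=> f; rewrite (Ex_marg1 j (F w) (fun=> hV w)).
by rewrite (Ex_cst _ (prod_pmf (fun=> hU w))).
Qed.

End Cloud.

(** * One-shot Marton coding with stochastic encoder and decoders *)

Section OneShot.
Variables (R : realType) (U V W X Y Z M K1 L1 K2 L2 : finType).
Variables (pW : W -> R) (pU : W -> U -> R) (pV : W -> V -> R).
Hypothesis hW : is_pmf pW.
Hypothesis hU : forall w, is_pmf (pU w).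
Hypothesis hV : forall w, is_pmf (pV w).
Variable rho : U -> V -> W -> R.
Hypothesis rho0 : forall u v w, 0 <= rho u v w.
Hypothesis rhoU : forall v w, Ex (pU w) (fun u => rho u v w) <= 1.
Hypothesis rhoV : forall u w, Ex (pV w) (fun v => rho u v w) <= 1.
Hypothesis rho1 : triE pW pU pV (fun w u v => rho u v w) = 1.
Variables (kx : U -> V -> W -> X -> R) (Q : X -> Y -> Z -> R).
Hypothesis hkx : forall u v w, is_pmf (kx u v w).
Hypothesis hQ : is_channel Q.
Variables (phi1 : U -> W -> Y -> bool) (phi2 : V -> W -> Z -> bool).
Variables g0 e1 e1' e2 e2' : R.
Hypothesis e1_ge : forall y, Ex pW (fun w => Ex (pU w) (fun u => (phi1 u w y)%:R)) <= e1.
Hypothesis e1'_ge : forall w y, Ex (pU w) (fun u => (phi1 u w y)%:R) <= e1'.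
Hypothesis e2_ge : forall z, Ex pW (fun w => Ex (pV w) (fun v => (phi2 v w z)%:R)) <= e2.
Hypothesis e2'_ge : forall w z, Ex (pV w) (fun v => (phi2 v w z)%:R) <= e2'.
Hypotheses (g0_ge0 : 0 <= g0) (e1_ge0 : 0 <= e1) (e1'_ge0 : 0 <= e1')
  (e2_ge0 : 0 <= e2) (e2'_ge0 : 0 <= e2').
Hypotheses (L1pos : (0 < #|L1|)%N) (L2pos : (0 < #|L2|)%N).

Definition obsP u v w (o : X * Y * Z) : R := kx u v w o.1.1 * Q o.1.1 o.1.2 o.2.

Definition good u v w (o : X * Y * Z) : bool :=
  [&& rho u v w <= g0, phi1 u w o.1.2 & phi2 v w o.2].

(** The weight [rho] turns the reference law into the true law of the auxiliary letters, so this is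
    the probability, without any codebook, that some test fails. *)
Definition fail_prob : R :=
  triE pW pU pV (fun w u v => rho u v w * \sum_o obsP u v w o * (~~ good u v w o)%:R).

Let hG w u v o : R := (good u v w o)%:R * rho u v w * obsP u v w o.

Lemma obsP_pmf u v w : is_pmf (obsP u v w).
Proof.
split=> [ob|].
  by apply: mulr_ge0; [case: (hkx u v w)|case: (hQ ob.1.1) => h _; apply: (h (ob.1.2, ob.2))].
rewrite sum_pair sum_pair /obsP /=.
under eq_bigr => x _ do (under eq_bigr do rewrite -mulr_sumr;
  rewrite -mulr_sumr -(sum_pair (fun yz => Q x yz.1 yz.2)) (proj2 (hQ x)) mulr1).
by case: (hkx u v w).
Qed.

Lemma hG_ge0 w u v o : 0 <= hG w u v o.
Proof.
rewrite mulr_ge0//; first exact: mulr_ge0.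
by case: (obsP_pmf u v w).
Qed.

Lemma sum_hG w u v : \sum_o hG w u v o <= rho u v w.
Proof.
rewrite -[leRHS]mulr1 -(proj2 (obsP_pmf u v w)) mulr_sumr.
apply: ler_sum => o _; rewrite ler_wpM2r ?(proj1 (obsP_pmf u v w))//.
by rewrite ler_piMl// lern1 leq_b1.
Qed.

Lemma triE_hG : triE pW pU pV (fun w u v => \sum_o hG w u v o) = 1 - fail_prob.
Proof.
rewrite -rho1 /fail_prob /triE -ExB; apply: eq_Ex => w; rewrite -ExB.
apply: eq_Ex => u; rewrite -ExB; apply: eq_Ex => v.
rewrite -[X in X - _]mulr1 -[X in _ * X - _](proj2 (obsP_pmf u v w)) -mulrBr -sumrB mulr_sumr.
apply: eq_bigr => o _; rewrite /hG -mulrA mulrCA; congr (_ * _).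
by case: good; rewrite /= ?mulr1 ?mulr0 ?mul1r ?mul0r ?subr0 ?subrr.
Qed.

Lemma fail_prob_ge0 : 0 <= fail_prob.
Proof.
rewrite -[leLHS](Ex_cst 0 hW); apply: le_Ex => [|w]; first by case: hW.
apply: Ex_ge0 => [|u]; first by case: (hU w).
apply: Ex_ge0 => [|v]; first by case: (hV w).
apply: mulr_ge0 => //; apply: sumr_ge0 => o _; apply: mulr_ge0 => //.
by case: (obsP_pmf u v w).
Qed.

Notation cl := (cloud U V W (K1 * L1)%type (K2 * L2)%type).
Notation clP := (@cloudP R U V W (K1 * L1)%type (K2 * L2)%type pW pU pV).
Notation codebook := {ffun M -> cl}.

Definition bookP (cb : codebook) : R := \prod_m clP (cb m).

Lemma bookP_pmf : is_pmf bookP.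
Proof. exact: prod_pmf (fun=> cloud_pmf _ _ hW hU hV). Qed.

(** The count runs over the bin index [l], which the decoder does not have to recover. *)
Definition num1 (cb : codebook) y (mk : M * K1) : R :=
  \sum_l (phi1 ((cb mk.1).1.2 (mk.2, l)) (cb mk.1).1.1 y)%:R.
Definition num2 (cb : codebook) z (mk : M * K2) : R :=
  \sum_l (phi2 ((cb mk.1).2 (mk.2, l)) (cb mk.1).1.1 z)%:R.

(* Kernels [dec1], [dec2], [enck] may have total mass 0 instead of 1, as x / 0 = 0. *)
Definition dec1 cb y mk : R := num1 cb y mk / \sum_mk' num1 cb y mk'.
Definition dec2 cb z mk : R := num2 cb z mk / \sum_mk' num2 cb z mk'.

Definition rhol (c : cl) k1 k2 (l : L1 * L2) : R :=
  rho (c.1.2 (k1, l.1)) (c.2 (k2, l.2)) c.1.1.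

Definition enck (cb : codebook) m k1 k2 x : R :=
  \sum_l rhol (cb m) k1 k2 l / (\sum_l' rhol (cb m) k1 k2 l') *
    kx ((cb m).1.2 (k1, l.1)) ((cb m).2 (k2, l.2)) (cb m).1.1 x.

Let hGl (c : cl) k1 k2 (l : L1 * L2) o : R :=
  hG c.1.1 (c.1.2 (k1, l.1)) (c.2 (k2, l.2)) o.

Let LL : R := (#|L1| * #|L2|)%N%:R.

Lemma ratio_ge (n o : R) : 1 <= n -> 0 <= o -> (1 + o)^-1 <= n / (n + o).
Proof.
move=> n1 o0; rewrite ler_pdivlMr; last lra.
rewrite mulrC ler_pdivrMr; last lra.
nra.
Qed.

Lemma num1_ge0 cb y mk : 0 <= num1 cb y mk.
Proof. exact: sumr_ge0. Qed.
Lemma num2_ge0 cb y mk : 0 <= num2 cb y mk.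
Proof. exact: sumr_ge0. Qed.

(** When the sent codeword passes its test the numerator is at least 1, and [n / (n + o)] increases
    with [n]. *)
Lemma dec1_ge (cb : codebook) y m k l : phi1 ((cb m).1.2 (k, l)) (cb m).1.1 y ->
  (1 + \sum_(mk | mk != (m, k)) num1 cb y mk)^-1 <= dec1 cb y (m, k).
Proof.
move=> ph; rewrite /dec1 [X in _ <= _ / X](bigD1 (m, k))//=; apply: ratio_ge.
  by rewrite /num1 (bigD1 l)//= ph lerDl sumr_ge0.
by apply: sumr_ge0 => mk _; apply: num1_ge0.
Qed.

Lemma dec2_ge (cb : codebook) z m k l : phi2 ((cb m).2 (k, l)) (cb m).1.1 z ->
  (1 + \sum_(mk | mk != (m, k)) num2 cb z mk)^-1 <= dec2 cb z (m, k).
Proof.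
move=> ph; rewrite /dec2 [X in _ <= _ / X](bigD1 (m, k))//=; apply: ratio_ge.
  by rewrite /num2 (bigD1 l)//= ph lerDl sumr_ge0.
by apply: sumr_ge0 => mk _; apply: num2_ge0.
Qed.

Lemma LL_gt0 : 0 < LL.
Proof. by rewrite ltr0n muln_gt0 L1pos. Qed.

(* With p = S / LL, q = 1 + o1 and r = 1 + o2, where o1 and o2 count the competing
   codewords, this is 1/(pqr) >= 4 - p - q - r. *)
Lemma correct_ge (cb : codebook) m k1 k2 l o :
  LL^-1 * (hGl (cb m) k1 k2 l o * (2
     - LL^-1 * \sum_l' rhol (cb m) k1 k2 l'
     - \sum_(mk | mk != (m, k1)) num1 cb o.1.2 mk
     - \sum_(mk | mk != (m, k2)) num2 cb o.2 mk)) <=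
  rhol (cb m) k1 k2 l / (\sum_l' rhol (cb m) k1 k2 l') *
  obsP ((cb m).1.2 (k1, l.1)) ((cb m).2 (k2, l.2)) (cb m).1.1 o *
  (dec1 cb o.1.2 (m, k1) * dec2 cb o.2 (m, k2)).
Proof.
set u := (cb m).1.2 _; set v := (cb m).2 _; set w := (cb m).1.1.
set S := \sum_l' _; set o1 := \sum_(mk | _) _; set o2 := \sum_(mk | _) _.
have ob0 : 0 <= obsP u v w o by case: (obsP_pmf u v w).
have S0 : 0 <= S by apply: sumr_ge0 => l' _; apply: rho0.
have d1_0 : 0 <= dec1 cb o.1.2 (m, k1).
  by rewrite mulr_ge0 ?num1_ge0// invr_ge0 sumr_ge0// => *; apply: num1_ge0.
have d2_0 : 0 <= dec2 cb o.2 (m, k2).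
  by rewrite mulr_ge0 ?num2_ge0// invr_ge0 sumr_ge0// => *; apply: num2_ge0.
have rl0 : 0 <= rhol (cb m) k1 k2 l by apply: rho0.
rewrite /hGl /hG -/u -/v -/w.
have [/and3P[_ p1 p2]|_] := boolP (good u v w o); last first.
  rewrite !mul0r mulr0; apply: mulr_ge0; last exact: mulr_ge0.
  by apply: mulr_ge0 => //; apply: mulr_ge0 => //; rewrite invr_ge0.
rewrite mul1r -/(rhol (cb m) k1 k2 l).
(* If the weight of the pair vanishes both sides are zero; otherwise [S] is positive and can be
   inverted. *)
have [->|rl] := eqVneq (rhol (cb m) k1 k2 l) 0; first by rewrite !mul0r mulr0.
have {}rl : 0 < rhol (cb m) k1 k2 l by rewrite lt_neqAle eq_sym rl.
have {}S0 : 0 < S.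
  by rewrite /S (bigD1 l)//= ltr_pwDl// sumr_ge0// => *; apply: rho0.
have o10 : 0 <= o1 by apply: sumr_ge0 => *; apply: num1_ge0.
have o20 : 0 <= o2 by apply: sumr_ge0 => *; apply: num2_ge0.
have D1 := dec1_ge p1; have D2 := dec2_ge p2; rewrite -/o1 -/o2 in D1 D2.
have LL0 := LL_gt0.
have key : 2 - LL^-1 * S - o1 - o2 <= LL * (S^-1 * ((1 + o1)^-1 * (1 + o2)^-1)).
  have -> : LL * (S^-1 * ((1 + o1)^-1 * (1 + o2)^-1)) =
      ((LL^-1 * S) * (1 + o1) * (1 + o2))^-1 by rewrite !invfM invrK !mulrA.
  apply: le_trans (inv_mul3_ge _ _ _); rewrite ?mulr_gt0 ?invr_gt0//; lra.
apply: (@le_trans _ _ (LL^-1 * (rhol (cb m) k1 k2 l * obsP u v w o *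
    (LL * (S^-1 * ((1 + o1)^-1 * (1 + o2)^-1)))))).
  apply: ler_wpM2l; first by rewrite invr_ge0 ltW.
  by apply: ler_wpM2l => //; apply: mulr_ge0.
have n1 : 1 + o1 != 0 by rewrite gt_eqF//; lra.
have n2 : 1 + o2 != 0 by rewrite gt_eqF//; lra.
rewrite (_ : LL^-1 * _ = rhol (cb m) k1 k2 l / S * obsP u v w o *
   ((1 + o1)^-1 * (1 + o2)^-1)); last first.
  by field; rewrite n1 n2 !pnatr_eq0 -!lt0n L1pos L2pos gt_eqF.
apply: ler_wpM2l; last by apply: ler_pM => //; rewrite invr_ge0; lra.
by apply: mulr_ge0 => //; apply: mulr_ge0 => //; rewrite invr_ge0 ltW.
Qed.


Lemma book_marg1 (F : cl -> R) m : Ex bookP (fun cb => F (cb m)) = Ex clP F.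
Proof. exact: (Ex_marg1 m F (fun=> cloud_pmf _ _ hW hU hV)). Qed.

Lemma book_marg2 (F : cl -> cl -> R) m m' : m != m' ->
  Ex bookP (fun cb => F (cb m) (cb m')) = Ex clP (fun c => Ex clP (F c)).
Proof. exact: (Ex_marg2 F (fun=> cloud_pmf _ _ hW hU hV)). Qed.

Lemma Ex_hGl m k1 k2 l :
  Ex bookP (fun cb => \sum_o hGl (cb m) k1 k2 l o) = 1 - fail_prob.
Proof.
rewrite (book_marg1 (fun c => \sum_o hGl c k1 k2 l o)) -triE_hG.
exact: (cloud_marg11 pW hU hV (fun w u v => \sum_o hG w u v o) (k1, l.1) (k2, l.2)).
Qed.

Lemma triE_hG_le1 : triE pW pU pV (fun w u v => \sum_o hG w u v o) <= 1.
Proof. by rewrite triE_hG; have := fail_prob_ge0; lra. Qed.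

(** For [l = l'] the weight appears twice, and the cutoff [rho <= g0] inside [good] controls one
    occurrence. For [l != l'] at least one satellite of the second pair is fresh, and averaging
    [rho] over it gives at most 1. *)
Lemma Ex_hGl_rhol m k1 k2 l l' :
  Ex bookP (fun cb => (\sum_o hGl (cb m) k1 k2 l o) * rhol (cb m) k1 k2 l')
  <= (l == l')%:R * g0 + 1.
Proof.
rewrite (book_marg1 (fun c => (\sum_o hGl c k1 k2 l o) * rhol c k1 k2 l')).
have U0 w u : 0 <= pU w u by case: (hU w).
have V0 w v : 0 <= pV w v by case: (hV w).
pose hS w u v := \sum_o hG w u v o.
have hS0 w u v : 0 <= hS w u v by apply: sumr_ge0 => o _; apply: hG_ge0.
have hS1 : triE pW pU pV hS <= 1 := triE_hG_le1.
have [<-|ll] := eqVneq l l'.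
  rewrite mul1r /rhol /hGl.
  rewrite (cloud_marg11 pW hU hV (fun w u v => hS w u v * rho u v w) (k1, l.1) (k2, l.2)).
  apply: (@le_trans _ _ (g0 * triE pW pU pV (fun w u v => rho u v w))); last first.
    by rewrite rho1 mulr1 lerDl.
  rewrite /triE -ExZ; apply: le_Ex => [|w]; first by case: hW.
  rewrite -ExZ; apply: le_Ex => // u; rewrite -ExZ; apply: le_Ex => // v.
  have [rg|rg] := leP (rho u v w) g0.
    rewrite mulrC; apply: ler_pM => //; exact: sum_hG.
  rewrite (_ : hS w u v = 0) ?mul0r ?mulr_ge0//.
  by apply: big1 => o _; rewrite /hG /good leNgt rg !mul0r.
rewrite mul0r add0r; apply: le_trans hS1.
have [e1eq|n1] := eqVneq l.1 l'.1; have [e2eq|n2] := eqVneq l.2 l'.2.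
- by case/eqP: ll; case: l l' e1eq e2eq => [? ?] [? ?] /= -> ->.
- have ne : (k2, l.2) != (k2, l'.2) by rewrite xpair_eqE eqxx.
  rewrite /rhol -e1eq.
  rewrite (cloud_marg12 pW hU hV (fun w u v v' => hS w u v * rho u v' w) (k1, l.1) ne).
  apply: le_triE => // w u v; rewrite ExZ -[leRHS]mulr1; exact: ler_wpM2l.
- have ne : (k1, l.1) != (k1, l'.1) by rewrite xpair_eqE eqxx.
  rewrite /rhol -e2eq.
  rewrite (cloud_marg21 pW hU hV (fun w u v u' => hS w u v * rho u' v w) (k2, l.2) ne).
  apply: le_triE => // w u v; rewrite ExZ -[leRHS]mulr1; exact: ler_wpM2l.
- have ne1 : (k1, l.1) != (k1, l'.1) by rewrite xpair_eqE eqxx.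
  have ne2 : (k2, l.2) != (k2, l'.2) by rewrite xpair_eqE eqxx.
  rewrite /rhol.
  rewrite (cloud_marg22 pW hU hV (fun w u v u' v' => hS w u v * rho u' v' w) ne1 ne2).
  apply: le_triE => // w u v.
  rewrite (@eq_Ex _ _ _ _ (fun u' => hS w u v * Ex (pV w) (fun v' => rho u' v' w))).
    rewrite ExZ -[leRHS]mulr1; apply: ler_wpM2l => //.
    exact: Ex_le_cst.
  by move=> u'; rewrite ExZ.
Qed.

(** A competitor from another cloud is independent of the transmission, which costs [e1]. One from
    the same cloud shares the center but has a fresh satellite, which costs [e1']. *)
Lemma Ex_hGl_phi1 m k1 k2 l m' k' l' : (m', k') != (m, k1) ->
  Ex bookP (fun cb => \sum_o hGl (cb m) k1 k2 l o *
     (phi1 ((cb m').1.2 (k', l')) (cb m').1.1 o.1.2)%:R) <=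
  e1 + (m' == m)%:R * e1'.
Proof.
move=> mk.
have [em|mm] := eqVneq m' m; last first.
  rewrite mul0r addr0 (@book_marg2 (fun c c' => \sum_o hGl c k1 k2 l o *
    (phi1 (c'.1.2 (k', l')) c'.1.1 o.1.2)%:R)) 1?eq_sym//.
  apply: (@le_trans _ _ (Ex clP (fun c => e1 * \sum_o hGl c k1 k2 l o))); last first.
    rewrite ExZ -[leRHS]mulr1 ler_wpM2l//.
    by rewrite (cloud_marg11 pW hU hV (fun w u v => \sum_o hG w u v o) (k1, l.1) (k2, l.2)) triE_hG_le1.
  apply: le_Ex => [c|c]; first exact: (proj1 (cloud_pmf _ _ hW hU hV)).
  rewrite Ex_sum mulr_sumr; apply: ler_sum => o _.
  rewrite ExZ mulrC ler_wpM2r ?hG_ge0//.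
  by rewrite (cloud_margU _ pW hU hV (fun w u => (phi1 u w o.1.2)%:R) (k', l')).
rewrite {m'}em in mk *.
rewrite mul1r; apply: (@le_trans _ _ e1'); last by rewrite lerDr.
have ne : (k1, l.1) != (k', l').
  by apply: contra mk => /eqP[-> _]; rewrite eqxx.
rewrite (book_marg1 (fun c => \sum_o hGl c k1 k2 l o *
  (phi1 (c.1.2 (k', l')) c.1.1 o.1.2)%:R)).
rewrite (cloud_marg21 pW hU hV (fun w u v u' => \sum_o hG w u v o * (phi1 u' w o.1.2)%:R) (k2, l.2) ne).
apply: (@le_trans _ _ (e1' * triE pW pU pV (fun w u v => \sum_o hG w u v o))); last first.
  by rewrite -[leRHS]mulr1 ler_wpM2l// triE_hG_le1.
rewrite /triE -ExZ; apply: le_Ex => [|w]; first by case: hW.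
rewrite -ExZ; apply: le_Ex => [|u]; first by case: (hU w).
rewrite -ExZ; apply: le_Ex => [|v]; first by case: (hV w).
rewrite Ex_sum mulr_sumr; apply: ler_sum => o _.
by rewrite ExZ mulrC ler_wpM2r ?hG_ge0.
Qed.

Lemma Ex_hGl_phi2 m k1 k2 l m' k' l' : (m', k') != (m, k2) ->
  Ex bookP (fun cb => \sum_o hGl (cb m) k1 k2 l o *
     (phi2 ((cb m').2 (k', l')) (cb m').1.1 o.2)%:R) <=
  e2 + (m' == m)%:R * e2'.
Proof.
move=> mk.
have [em|mm] := eqVneq m' m; last first.
  rewrite mul0r addr0 (@book_marg2 (fun c c' => \sum_o hGl c k1 k2 l o *
    (phi2 (c'.2 (k', l')) c'.1.1 o.2)%:R)) 1?eq_sym//.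
  apply: (@le_trans _ _ (Ex clP (fun c => e2 * \sum_o hGl c k1 k2 l o))); last first.
    rewrite ExZ -[leRHS]mulr1 ler_wpM2l//.
    by rewrite (cloud_marg11 pW hU hV (fun w u v => \sum_o hG w u v o) (k1, l.1) (k2, l.2)) triE_hG_le1.
  apply: le_Ex => [c|c]; first exact: (proj1 (cloud_pmf _ _ hW hU hV)).
  rewrite Ex_sum mulr_sumr; apply: ler_sum => o _.
  rewrite ExZ mulrC ler_wpM2r ?hG_ge0//.
  by rewrite (cloud_margV _ pW hU hV (fun w v => (phi2 v w o.2)%:R) (k', l')).
rewrite {m'}em in mk *.
rewrite mul1r; apply: (@le_trans _ _ e2'); last by rewrite lerDr.
have ne : (k2, l.2) != (k', l').
  by apply: contra mk => /eqP[-> _]; rewrite eqxx.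
rewrite (book_marg1 (fun c => \sum_o hGl c k1 k2 l o *
  (phi2 (c.2 (k', l')) c.1.1 o.2)%:R)).
rewrite (cloud_marg12 pW hU hV (fun w u v v' => \sum_o hG w u v o * (phi2 v' w o.2)%:R) (k1, l.1) ne).
apply: (@le_trans _ _ (e2' * triE pW pU pV (fun w u v => \sum_o hG w u v o))); last first.
  by rewrite -[leRHS]mulr1 ler_wpM2l// triE_hG_le1.
rewrite /triE -ExZ; apply: le_Ex => [|w]; first by case: hW.
rewrite -ExZ; apply: le_Ex => [|u]; first by case: (hU w).
rewrite -ExZ; apply: le_Ex => [|v]; first by case: (hV w).
rewrite Ex_sum mulr_sumr; apply: ler_sum => o _.
by rewrite ExZ mulrC ler_wpM2r ?hG_ge0.
Qed.

(** Competitors inside the sent cloud number exactly one less than the satellite indices. Keeping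
    this [- 1] lets the second term vanish when there is a single satellite index. *)
Lemma sum_other_le (K : finType) (m : M) (k : K) (a b : R) : 0 <= a ->
  \sum_(mk | mk != (m, k)) (a + (mk.1 == m)%:R * b) <=
  #|M|%:R * #|K|%:R * a + (#|K|%:R - 1) * b.
Proof.
move=> a0; rewrite big_split /= -mulr_suml lerD//.
  rewrite sumr_const -[a *+ _]mulr_natl ler_wpM2r// -natrM ler_nat -card_prod.
  exact: max_card.
rewrite (_ : \sum_(mk | _) _ = #|K|%:R - 1)//.
have : \sum_(mk : M * K) (mk.1 == m)%:R = #|K|%:R :> R.
  rewrite sum_pair (bigD1 m)//= [X in _ + X]big1 ?addr0 => [|m' /negbTE e].
    by rewrite eqxx sumr_const.
  by rewrite e big1.
rewrite (bigD1 (m, k))//= eqxx => <-; by rewrite addrAC subrr add0r.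
Qed.

Definition correct (cb : codebook) m k1 k2 : R :=
  \sum_l \sum_o rhol (cb m) k1 k2 l / (\sum_l' rhol (cb m) k1 k2 l') *
  obsP ((cb m).1.2 (k1, l.1)) ((cb m).2 (k2, l.2)) (cb m).1.1 o *
  (dec1 cb o.1.2 (m, k1) * dec2 cb o.2 (m, k2)).

(** The terms are, in order: failure of the tests on the true codewords, scarcity of satellite pairs
    for the encoder, and false alarms at each receiver. *)
Definition err_bound : R := 2 * fail_prob + g0 / LL
  + #|L1|%:R * (#|M|%:R * #|K1|%:R * e1 + (#|K1|%:R - 1) * e1')
  + #|L2|%:R * (#|M|%:R * #|K2|%:R * e2 + (#|K2|%:R - 1) * e2').

(** The bracket [2 - p - o1 - o2] has mean at least [2 (1 - fail_prob) - (g0 / LL + 1)] minus the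
    false-alarm terms, once weighted by the good event. This leaves 1 and explains the factor 2 in
    front of [fail_prob]. *)
Lemma Ex_correct m k1 k2 : 1 - err_bound <= Ex bookP (fun cb => correct cb m k1 k2).
Proof.
have LL0 := LL_gt0.
have cardL : #|{: L1 * L2}|%:R = LL by rewrite card_prod.
(* The linearized lower bound for the pair [l], summed over outputs and expanded so that each
   expectation is one already bounded. *)
pose br (l : L1 * L2) (cb : codebook) : R :=
  2 * (\sum_o hGl (cb m) k1 k2 l o)
  - LL^-1 * (\sum_l' (\sum_o hGl (cb m) k1 k2 l o) * rhol (cb m) k1 k2 l')
  - (\sum_(mk | mk != (m, k1)) \sum_l' \sum_o hGl (cb m) k1 k2 l o *
     (phi1 ((cb mk.1).1.2 (mk.2, l')) (cb mk.1).1.1 o.1.2)%:R)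
  - (\sum_(mk | mk != (m, k2)) \sum_l' \sum_o hGl (cb m) k1 k2 l o *
     (phi2 ((cb mk.1).2 (mk.2, l')) (cb mk.1).1.1 o.2)%:R).
apply: (@le_trans _ _ (Ex bookP (fun cb => \sum_l LL^-1 * br l cb))); last first.
  apply: le_Ex => [|cb]; first by case: bookP_pmf.
  apply: ler_sum => l _.
  apply: le_trans (ler_sum _ (fun o _ => correct_ge cb m k1 k2 l o)).
  rewrite -mulr_sumr; apply: ler_wpM2l; first by rewrite invr_ge0 ltW.
  rewrite /br.
  rewrite le_eqVlt; apply/orP; left; apply/eqP.
  under [RHS]eq_bigr do rewrite !mulrBr.
  rewrite !sumrB; congr (_ - _ - _ - _).
  - by rewrite -mulr_suml mulrC.
  - by rewrite -mulr_suml -mulr_sumr mulrCA.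
  - under [RHS]eq_bigr do rewrite mulr_sumr.
    rewrite [RHS]exchange_big /=; apply: eq_bigr => mk _.
    rewrite exchange_big /=; apply: eq_bigr => o _.
    by rewrite /num1 mulr_sumr.
  - under [RHS]eq_bigr do rewrite mulr_sumr.
    rewrite [RHS]exchange_big /=; apply: eq_bigr => mk _.
    rewrite exchange_big /=; apply: eq_bigr => o _.
    by rewrite /num2 mulr_sumr.
have brE l : 1 - err_bound <= Ex bookP (br l).
  rewrite /br !ExB ExZ ExZ Ex_hGl !Ex_sum.
  have h1 : LL^-1 * (\sum_l' Ex bookP (fun cb =>
      (\sum_o hGl (cb m) k1 k2 l o) * rhol (cb m) k1 k2 l')) <= g0 / LL + 1.
    apply: (@le_trans _ _ (LL^-1 * (\sum_l' ((l == l')%:R * g0 + 1)))).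
      apply: ler_wpM2l; first by rewrite invr_ge0 ltW.
      apply: ler_sum => l' _.
      exact: Ex_hGl_rhol.
    rewrite big_split /= sumr_const cardL -mulr_suml (bigD1 l)//= eqxx.
    rewrite big1 ?addr0 ?mul1r => [|l' /negbTE]; last by rewrite eq_sym => ->.
    by rewrite mulrDr mulVf ?gt_eqF// mulrC.
  have h2 : \sum_(mk | mk != (m, k1)) Ex bookP (fun cb => \sum_l' \sum_o
      hGl (cb m) k1 k2 l o *
     (phi1 ((cb mk.1).1.2 (mk.2, l')) (cb mk.1).1.1 o.1.2)%:R) <=
     #|L1|%:R * (#|M|%:R * #|K1|%:R * e1 + (#|K1|%:R - 1) * e1').
    apply: (@le_trans _ _ (\sum_(mk | mk != (m, k1)) #|L1|%:R * (e1 + (mk.1 == m)%:R * e1'))).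
      apply: ler_sum => -[m' k'] mk; rewrite Ex_sum mulr_natl -sumr_const.
      by apply: ler_sum => l' _; apply: Ex_hGl_phi1.
    by rewrite -mulr_sumr ler_wpM2l// sum_other_le.
  have h3 : \sum_(mk | mk != (m, k2)) Ex bookP (fun cb => \sum_l' \sum_o
      hGl (cb m) k1 k2 l o *
     (phi2 ((cb mk.1).2 (mk.2, l')) (cb mk.1).1.1 o.2)%:R) <=
     #|L2|%:R * (#|M|%:R * #|K2|%:R * e2 + (#|K2|%:R - 1) * e2').
    apply: (@le_trans _ _ (\sum_(mk | mk != (m, k2)) #|L2|%:R * (e2 + (mk.1 == m)%:R * e2'))).
      apply: ler_sum => -[m' k'] mk; rewrite Ex_sum mulr_natl -sumr_const.
      by apply: ler_sum => l' _; apply: Ex_hGl_phi2.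
    by rewrite -mulr_sumr ler_wpM2l// sum_other_le.
  rewrite /err_bound; move: h1 h2 h3; lra.
rewrite Ex_sum; under eq_bigr do rewrite ExZ.
rewrite -mulr_sumr mulrC ler_pdivlMr//.
apply: (@le_trans _ _ (\sum_(l : L1 * L2) (1 - err_bound))).
  by rewrite sumr_const -[_ *+ _]mulr_natr cardL.
by apply: ler_sum => l _; apply: brE.
Qed.

Lemma sum_ratio_le1 (A : finType) (F : A -> R) : (forall a, 0 <= F a) ->
  \sum_a F a / (\sum_b F b) <= 1.
Proof.
move=> F0; rewrite -mulr_suml; have [->|n] := eqVneq (\sum_b F b) 0.
  by rewrite mul0r.
by rewrite divff.
Qed.

(** Averaging the sum over all messages yields one codebook good for that sum. The success
    probability is then linear in the encoder and in each decoder separately, so the three are made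
    deterministic one after the other. *)
Lemma one_shot (T : finType) (x0 : X) (t0 : T) (mm : T -> M) (kk1 : T -> K1)
    (kk2 : T -> K2) :
  exists (enc : T -> X) (d1 : Y -> M * K1) (d2 : Z -> M * K2),
    #|T|%:R * (1 - err_bound) <=
    \sum_t \sum_y \sum_z Q (enc t) y z * ((d1 y == (mm t, kk1 t))%:R *
      (d2 z == (mm t, kk2 t))%:R).
Proof.
have Q0 x y z : 0 <= Q x y z by have [h _] := hQ x; apply: (h (y, z)).
have [cb hcb] := exists_ge_Ex (fun cb => \sum_t correct cb (mm t) (kk1 t) (kk2 t)) bookP_pmf.
have {hcb} : #|T|%:R * (1 - err_bound) <= \sum_t correct cb (mm t) (kk1 t) (kk2 t).
  apply: le_trans hcb; rewrite Ex_sum mulr_natl -sumr_const.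
  by apply: ler_sum => t _; apply: Ex_correct.
have D10 y mk : 0 <= dec1 cb y mk.
  by rewrite mulr_ge0 ?num1_ge0// invr_ge0 sumr_ge0// => *; apply: num1_ge0.
have D20 z mk : 0 <= dec2 cb z mk.
  by rewrite mulr_ge0 ?num2_ge0// invr_ge0 sumr_ge0// => *; apply: num2_ge0.
have R0 (c : cl) k1 k2 (l : L1 * L2) : 0 <= rhol c k1 k2 l /
    (\sum_l' rhol c k1 k2 l').
  by apply: mulr_ge0; rewrite ?invr_ge0 ?sumr_ge0// => *; apply: rho0.
pose F1 t x := \sum_y \sum_z Q x y z *
  (dec1 cb y (mm t, kk1 t) * dec2 cb z (mm t, kk2 t)).
have -> : \sum_t correct cb (mm t) (kk1 t) (kk2 t) =
    \sum_t \sum_x enck cb (mm t) (kk1 t) (kk2 t) x * F1 t x.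
  apply: eq_bigr => t _; rewrite /correct /enck.
  under [RHS]eq_bigr do rewrite mulr_suml.
  rewrite [RHS]exchange_big /=.
  apply: eq_bigr => l _; rewrite sum_pair sum_pair; apply: eq_bigr => x _ /=.
  rewrite mulr_sumr; apply: eq_bigr => y _; rewrite mulr_sumr.
  by apply: eq_bigr => z _; rewrite /obsP /= !mulrA.
have [|||enc henc] := @derandomize _ _ _ x0 (fun t => enck cb (mm t) (kk1 t) (kk2 t)) F1.
- move=> t x; apply: sumr_ge0 => l _; apply: mulr_ge0 => //.
  exact: (proj1 (hkx _ _ _)).
- move=> t; rewrite exchange_big /=.
  under eq_bigr do rewrite -mulr_sumr (proj2 (hkx _ _ _)) mulr1.
  by apply: sum_ratio_le1 => l; apply: rho0.
- move=> t x; apply: sumr_ge0 => y _; apply: sumr_ge0 => z _.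
  by apply: mulr_ge0 => //; apply: mulr_ge0.
move=> /le_trans/(_ henc).
(* Regroup by the output [y] to exhibit linearity in [dec1]; the same is done below for [dec2]. *)
have -> : \sum_t F1 t (enc t) = \sum_y \sum_mk dec1 cb y mk *
   (\sum_t \sum_z Q (enc t) y z * ((mk == (mm t, kk1 t))%:R * dec2 cb z (mm t, kk2 t))).
  rewrite /F1 exchange_big /=; apply: eq_bigr => y _.
  under [RHS]eq_bigr do rewrite mulr_sumr.
  rewrite [RHS]exchange_big /=.
  apply: eq_bigr => t _; rewrite [RHS](bigD1 (mm t, kk1 t))//= eqxx.
  rewrite [X in _ + X]big1 ?addr0 => [|mk /negbTE e].
    by rewrite mulr_sumr; apply: eq_bigr => z _; rewrite mul1r mulrCA.
  by rewrite big1 ?mulr0// => z _; rewrite e mul0r mulr0.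
have [|||d1 hd1] := @derandomize _ _ _ (mm t0, kk1 t0) (dec1 cb) (fun y mk =>
  \sum_t \sum_z Q (enc t) y z * ((mk == (mm t, kk1 t))%:R * dec2 cb z (mm t, kk2 t))).
- exact: D10.
- by move=> y; apply: sum_ratio_le1 => mk; apply: num1_ge0.
- move=> y mk; apply: sumr_ge0 => t _; apply: sumr_ge0 => z _.
  by apply: mulr_ge0 => //; apply: mulr_ge0.
move=> /le_trans/(_ hd1).
have -> : \sum_y \sum_t \sum_z Q (enc t) y z * ((d1 y == (mm t, kk1 t))%:R *
    dec2 cb z (mm t, kk2 t)) = \sum_z \sum_mk dec2 cb z mk *
   (\sum_t \sum_y Q (enc t) y z * ((d1 y == (mm t, kk1 t))%:R * (mk == (mm t, kk2 t))%:R)).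
  rewrite exchange_big /=; under eq_bigr do rewrite exchange_big /=.
  rewrite exchange_big /=; apply: eq_bigr => z _.
  under [RHS]eq_bigr do rewrite mulr_sumr.
  rewrite [RHS]exchange_big /=.
  apply: eq_bigr => t _; rewrite [RHS](bigD1 (mm t, kk2 t))//= eqxx.
  rewrite [X in _ + X]big1 ?addr0 => [|mk /negbTE e].
    rewrite mulr_sumr; apply: eq_bigr => y _.
    by rewrite mulr1 mulrA mulrC.
  by rewrite big1 ?mulr0// => y _; rewrite e !mulr0.
have [|||d2 hd2] := @derandomize _ _ _ (mm t0, kk2 t0) (dec2 cb) (fun z mk =>
  \sum_t \sum_y Q (enc t) y z * ((d1 y == (mm t, kk1 t))%:R * (mk == (mm t, kk2 t))%:R)).
- exact: D20.
- by move=> z; apply: sum_ratio_le1 => mk; apply: num2_ge0.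
- move=> z mk; apply: sumr_ge0 => t _; apply: sumr_ge0 => y _.
  by apply: mulr_ge0 => //; apply: mulr_ge0.
move=> /le_trans/(_ hd2) H; exists enc, d1, d2; apply: le_trans H _.
rewrite exchange_big /=; apply: ler_sum => t _.
by rewrite exchange_big.
Qed.

End OneShot.

(** * Marginals, conditional laws and information densities *)

Section Densities.
Variables (R : realType) (T : finType) (P : T -> R).
Hypothesis hP : is_pmf P.
Implicit Types A B C : finType.

Definition marg (A : finType) (f : T -> A) (a : A) : R := \sum_(t | f t == a) P t.

Lemma marg_ge0 A (f : T -> A) a : 0 <= marg f a.
Proof. by apply: sumr_ge0 => t _; case: hP. Qed.

Lemma marg_gt0 A (f : T -> A) t : 0 < P t -> 0 < marg f (f t).
Proof.
move=> Pt; rewrite /marg (bigD1 t)//= ltr_pwDl// sumr_ge0// => s _.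
by case: hP.
Qed.

Lemma sum_marg A (f : T -> A) (g : A -> R) :
  \sum_a marg f a * g a = \sum_t P t * g (f t).
Proof.
rewrite (partition_big f xpredT)//=; apply: eq_bigr => a _.
by rewrite mulr_suml; apply: eq_bigr => t /eqP ->.
Qed.

Lemma marg_pmf A (f : T -> A) : is_pmf (marg f).
Proof.
split; first exact: marg_ge0.
have := sum_marg f (fun=> 1); rewrite -!mulr_suml !mulr1 => ->.
by case: hP.
Qed.

Lemma marg_comp A B (f : T -> A) (g : A -> B) b :
  marg (g \o f) b = \sum_(a | g a == b) marg f a.
Proof.
have := sum_marg f (fun a => (g a == b)%:R).
rewrite [in RHS](eq_bigr (fun t => if g (f t) == b then P t else 0)); last first.
  by move=> t _; case: eqP; rewrite ?mulr1 ?mulr0.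
rewrite -big_mkcond /= => e; rewrite [LHS]/marg /= -e [RHS]big_mkcond; apply: eq_bigr => a _.
by case: eqP; rewrite ?mulr1 ?mulr0.
Qed.

Lemma marg_pairr A B (f : T -> A) (g : T -> B) b :
  \sum_a marg (fun t => (f t, g t)) (a, b) = marg g b.
Proof.
rewrite -[RHS]/(marg (snd \o (fun t => (f t, g t))) b) marg_comp.
rewrite [RHS]big_mkcond sum_pair; apply: eq_bigr => a _ /=.
by rewrite -big_mkcond big_pred1_eq.
Qed.

Lemma entropyE A (f : T -> A) : entropy P f = - \sum_t P t * ln (marg f (f t)).
Proof. by rewrite -(sum_marg f (fun a => ln (marg f a))). Qed.

(** The exponential of the information density of [a] and [b]; it is 0 when a marginal vanishes,
    since [x / 0 = 0]. *)
Definition mdens (A B : finType) (a : T -> A) (b : T -> B) x y : R :=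
  marg (fun t => (a t, b t)) (x, y) / (marg a x * marg b y).

(** The ratio [p(x,y|z) / (p(x|z) p(y|z))], cleared of conditional probabilities. *)
Definition cdens (A B C : finType) (a : T -> A) (b : T -> B) (c : T -> C) x y z : R :=
  marg (fun t => (a t, b t, c t)) (x, y, z) * marg c z /
  (marg (fun t => (a t, c t)) (x, z) * marg (fun t => (b t, c t)) (y, z)).

Lemma mdens_ge0 A B (a : T -> A) (b : T -> B) x y : 0 <= mdens a b x y.
Proof. by rewrite mulr_ge0 ?invr_ge0 ?mulr_ge0 ?marg_ge0. Qed.

Lemma cdens_ge0 A B C (a : T -> A) (b : T -> B) (c : T -> C) x y z :
  0 <= cdens a b c x y z.
Proof. by rewrite !mulr_ge0 ?invr_ge0 ?mulr_ge0 ?marg_ge0. Qed.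

Lemma mdens_gt0 A B (a : T -> A) (b : T -> B) t : 0 < P t -> 0 < mdens a b (a t) (b t).
Proof.
by move=> Pt; rewrite divr_gt0 ?mulr_gt0 ?marg_gt0.
Qed.

Lemma cdens_gt0 A B C (a : T -> A) (b : T -> B) (c : T -> C) t : 0 < P t ->
  0 < cdens a b c (a t) (b t) (c t).
Proof.
move=> Pt; rewrite divr_gt0 ?mulr_gt0//.
- exact: (marg_gt0 (fun t => (a t, b t, c t)) Pt).
- exact: marg_gt0.
- exact: (marg_gt0 (fun t => (a t, c t)) Pt).
- exact: (marg_gt0 (fun t => (b t, c t)) Pt).
Qed.

Lemma eq_supp (F G : T -> R) : (forall t, 0 < P t -> F t = G t) ->
  \sum_t P t * F t = \sum_t P t * G t.
Proof.
move=> FG; apply: eq_bigr => t _.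
have [->|n] := eqVneq (P t) 0; first by rewrite !mul0r.
by rewrite FG// lt_neqAle eq_sym n /=; case: hP.
Qed.

Lemma minfoE A B (a : T -> A) (b : T -> B) :
  minfo P a b = \sum_t P t * ln (mdens a b (a t) (b t)).
Proof.
rewrite /minfo !entropyE.
rewrite [RHS](@eq_supp _ (fun t => ln (marg (fun t => (a t, b t)) (a t, b t))
  - ln (marg a (a t)) - ln (marg b (b t)))).
  by under [RHS]eq_bigr do rewrite !mulrBr; rewrite !sumrB; ring.
move=> t Pt; have ma := marg_gt0 a Pt; have mb := marg_gt0 b Pt.
have mab := marg_gt0 (fun t => (a t, b t)) Pt.
by rewrite /mdens ln_div ?lnM ?posrE ?mulr_gt0//; ring.
Qed.

Lemma cminfoE A B C (a : T -> A) (b : T -> B) (c : T -> C) :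
  cminfo P a b c = \sum_t P t * ln (cdens a b c (a t) (b t) (c t)).
Proof.
rewrite /cminfo !entropyE.
rewrite [RHS](@eq_supp _ (fun t => ln (marg (fun t => (a t, b t, c t)) (a t, b t, c t))
  + ln (marg c (c t)) - ln (marg (fun t => (a t, c t)) (a t, c t))
  - ln (marg (fun t => (b t, c t)) (b t, c t)))).
  by under [RHS]eq_bigr do rewrite !mulrBr mulrDr; rewrite !sumrB big_split /=; ring.
move=> t Pt; have mc := marg_gt0 c Pt.
have mac := marg_gt0 (fun t => (a t, c t)) Pt.
have mbc := marg_gt0 (fun t => (b t, c t)) Pt.
have mabc := marg_gt0 (fun t => (a t, b t, c t)) Pt.
by rewrite /cdens ln_div ?lnM ?posrE ?mulr_gt0//; ring.
Qed.

(** A letter drawn independently of [y] sees a density of mean at most 1, which bounds false alarms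
    through Markov's inequality. The sum is 0 instead of 1 when [y] has probability zero. *)
Lemma mdens_sum A B (a : T -> A) (b : T -> B) y :
  \sum_x marg a x * mdens a b x y <= 1.
Proof.
apply: (@le_trans _ _ (\sum_x marg (fun t => (a t, b t)) (x, y) / marg b y)).
  apply: ler_sum => x _; rewrite /mdens.
  have [->|n] := eqVneq (marg a x) 0.
    by rewrite mul0r divr_ge0 ?marg_ge0.
  have [->|k] := eqVneq (marg b y) 0; first by rewrite mulr0 invr0 !mulr0.
  by rewrite le_eqVlt; apply/orP; left; apply/eqP; field; rewrite n k.
rewrite -mulr_suml marg_pairr; have [->|n] := eqVneq (marg b y) 0.
  by rewrite mul0r.
by rewrite divff.
Qed.

(* The fallback to the marginal law keeps this a pmf when [c = z] has probability zero. *)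
Definition cond (A C : finType) (a : T -> A) (c : T -> C) (z : C) (x : A) : R :=
  if marg c z == 0 then marg a x else marg (fun t => (a t, c t)) (x, z) / marg c z.

Lemma cond_pmf A C (a : T -> A) (c : T -> C) z : is_pmf (cond a c z).
Proof.
rewrite /cond; have [e|n] := eqVneq (marg c z) 0; first exact: marg_pmf.
split=> [x|]; first by rewrite divr_ge0 ?marg_ge0.
by rewrite -mulr_suml marg_pairr divff.
Qed.

Lemma marg_le A B (f : T -> A) (g : T -> B) (h : A -> B) a : (forall t, g t = h (f t)) ->
  marg f a <= marg g (h a).
Proof.
move=> gh; rewrite /marg [leLHS]big_mkcond [leRHS]big_mkcond.
apply: ler_sum => t _; case: eqP => [e|_]; first by rewrite gh e eqxx.
by case: ifP => // _; case: hP.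
Qed.

Lemma marg_cond A C (a : T -> A) (c : T -> C) z x :
  marg c z * cond a c z x = marg (fun t => (a t, c t)) (x, z).
Proof.
rewrite /cond; case: ifPn => [/eqP e|n]; last by rewrite mulrC divfK.
rewrite e mul0r; apply/eqP; rewrite eq_le marg_ge0 /= -e.
exact: (@marg_le _ _ (fun t => (a t, c t)) c snd).
Qed.

Lemma cdens_suml A B C (a : T -> A) (b : T -> B) (c : T -> C) y z :
  \sum_x cond a c z x * cdens a b c x y z <= 1.
Proof.
have [e|n] := eqVneq (marg c z) 0.
  by rewrite big1// => x _; rewrite /cdens e mulr0 mul0r mulr0.
apply: (@le_trans _ _ (\sum_x marg (fun t => (a t, b t, c t)) (x, y, z)
    / marg (fun t => (b t, c t)) (y, z))).
  apply: ler_sum => x _; rewrite /cdens /cond (negbTE n).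
  have [->|m] := eqVneq (marg (fun t => (a t, c t)) (x, z)) 0.
    by rewrite !mul0r divr_ge0 ?marg_ge0.
  have [->|k] := eqVneq (marg (fun t => (b t, c t)) (y, z)) 0.
    by rewrite mulr0 invr0 !mulr0.
  by rewrite le_eqVlt; apply/orP; left; apply/eqP; field; rewrite m n k.
rewrite -mulr_suml.
have -> : \sum_x marg (fun t => (a t, b t, c t)) (x, y, z) =
    marg (fun t => (b t, c t)) (y, z).
  rewrite -(marg_pairr a (fun t => (b t, c t)) (y, z)); apply: eq_bigr => x _.
  by apply: eq_bigl => t; rewrite !xpair_eqE andbA.
have [->|k] := eqVneq (marg (fun t => (b t, c t)) (y, z)) 0.
  by rewrite mul0r.
by rewrite divff.
Qed.

Lemma cdens_sumr A B C (a : T -> A) (b : T -> B) (c : T -> C) x z :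
  \sum_y cond b c z y * cdens a b c x y z <= 1.
Proof.
apply: le_trans (cdens_suml b a c x z).
apply: ler_sum => y _; rewrite ler_wpM2l ?(proj1 (cond_pmf b c z))//.
rewrite /cdens [X in _ / X]mulrC.
rewrite (_ : marg (fun t => (a t, b t, c t)) (x, y, z) =
  marg (fun t => (b t, a t, c t)) (y, x, z))//.
by apply: eq_bigl => t; rewrite !xpair_eqE; case: (a t == x); case: (b t == y).
Qed.

(** Change of measure from conditional independence to the joint law. Where a denominator vanishes,
    so does the right side, because each marginal involved dominates the joint one. *)
Lemma cond_cdens A B C (a : T -> A) (b : T -> B) (c : T -> C) x y z :
  marg c z * (cond a c z x * (cond b c z y * cdens a b c x y z)) =
  marg (fun t => (a t, b t, c t)) (x, y, z).
Proof.
have le1 : marg (fun t => (a t, b t, c t)) (x, y, z) <= marg c z.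
  exact: (@marg_le _ _ (fun t => (a t, b t, c t)) c snd).
have le2 : marg (fun t => (a t, b t, c t)) (x, y, z) <= marg (fun t => (a t, c t)) (x, z).
  exact: (@marg_le _ _ (fun t => (a t, b t, c t)) (fun t => (a t, c t)) (fun s => (s.1.1, s.2))).
have le3 : marg (fun t => (a t, b t, c t)) (x, y, z) <= marg (fun t => (b t, c t)) (y, z).
  exact: (@marg_le _ _ (fun t => (a t, b t, c t)) (fun t => (b t, c t)) (fun s => (s.1.2, s.2))).
have z0 : marg (fun t => (a t, b t, c t)) (x, y, z) <= 0 ->
    marg (fun t => (a t, b t, c t)) (x, y, z) = 0.
  by move=> h; apply/eqP; rewrite eq_le h marg_ge0.
have [e|n] := eqVneq (marg c z) 0.
  by rewrite e mul0r z0// -e.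
rewrite /cdens /cond (negbTE n).
have [e|m] := eqVneq (marg (fun t => (a t, c t)) (x, z)) 0.
  by rewrite e !mul0r mulr0 z0// -e.
have [e|k] := eqVneq (marg (fun t => (b t, c t)) (y, z)) 0.
  by rewrite e !mul0r !mulr0 z0// -e.
by field; rewrite m n k.
Qed.

(** Use [ln d >= 1 - 1/d]; the mean of [1/d] is at most the total mass of [p(z) p(x|z) p(y|z)],
    which is 1. *)
Lemma cminfo_ge0 A B C (a : T -> A) (b : T -> B) (c : T -> C) : 0 <= cminfo P a b c.
Proof.
rewrite cminfoE.
apply: (@le_trans _ _ (\sum_t P t * (1 - (cdens a b c (a t) (b t) (c t))^-1))).
  under eq_bigr do rewrite mulrBr mulr1; rewrite sumrB (proj2 hP) subr_ge0.
  pose G (s : A * B * C) := (cdens a b c s.1.1 s.1.2 s.2)^-1.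
  rewrite -(sum_marg (fun t => (a t, b t, c t)) G).
  apply: (@le_trans _ _ (\sum_(s : A * B * C) marg c s.2 * (cond a c s.2 s.1.1 * cond b c s.2 s.1.2))).
    apply: ler_sum => -[[x y] z] _; rewrite /G /= -cond_cdens.
    have [->|n] := eqVneq (cdens a b c x y z) 0.
      rewrite invr0 mulr0 !mulr_ge0 ?marg_ge0//.
        by case: (cond_pmf a c z).
      by case: (cond_pmf b c z).
    by move: (cdens a b c x y z) n => d n; rewrite !mulrA mulfK.
  rewrite sum_pair exchange_big /= -(proj2 (marg_pmf c)).
  apply: ler_sum => z _; rewrite sum_pair /=.
  under eq_bigr do rewrite -mulr_sumr -mulr_sumr (proj2 (cond_pmf b c z)) mulr1.
  by rewrite -mulr_sumr (proj2 (cond_pmf a c z)) mulr1.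
apply: ler_sum => t _.
have [->|n] := eqVneq (P t) 0; first by rewrite !mul0r.
have Pt : 0 < P t by rewrite lt_neqAle eq_sym n /=; case: hP.
rewrite ler_wpM2l ?(ltW Pt)//.
have d0 := cdens_gt0 a b c Pt.
have := expR_ge1Dx (- ln (cdens a b c (a t) (b t) (c t))).
rewrite expRN lnK ?posrE//; lra.
Qed.

End Densities.

(** * Pairs of sequences as sequences of pairs *)

Section FfunPairs.
Variables (R : realType) (I A B : finType).

Definition fpair (f : {ffun I -> A}) (g : {ffun I -> B}) : {ffun I -> A * B} :=
  [ffun i => (f i, g i)].
Definition ffst (h : {ffun I -> A * B}) : {ffun I -> A} := [ffun i => (h i).1].
Definition fsnd (h : {ffun I -> A * B}) : {ffun I -> B} := [ffun i => (h i).2].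

Lemma sum_ffun_pair (F : {ffun I -> A} -> {ffun I -> B} -> R) :
  \sum_f \sum_g F f g = \sum_h F (ffst h) (fsnd h).
Proof.
rewrite pair_bigA /=.
rewrite (reindex (fun h : {ffun I -> A * B} => (ffst h, fsnd h)))//=.
exists (fun x => fpair x.1 x.2) => [h _|[f g] _] /=.
  by apply/ffunP => i; rewrite !ffunE; case: (h i).
by congr (_, _); apply/ffunP => i; rewrite !ffunE.
Qed.

End FfunPairs.

(** * The law of the theorem as a window of the source path *)

Section NLetter.
Variables (R : realType) (U V W X Y Z : finType).
Variables (q : X -> Y -> Z -> R) (r3 : U -> V -> W -> R).
Variable rx : U -> V -> W -> U -> V -> W -> X -> R.
Hypothesis hq : is_channel q.
Hypothesis hr3 : is_pmf (fun a : U * V * W => r3 a.1.1 a.1.2 a.2).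
Hypothesis hrx : forall u1 v1 w1 u2 v2 w2, is_pmf (rx u1 v1 w1 u2 v2 w2).

Notation S := (U * V * W)%type.
Notation obs := (X * Y * Z)%type.
Notation P := (joint q r3 rx).

Definition srcP (s : S) : R := r3 s.1.1 s.1.2 s.2.
Definition rxS (s s' : S) (x : X) : R := rx s.1.1 s.1.2 s.2 s'.1.1 s'.1.2 s'.2 x.
Definition kapS (s s' : S) (o : obs) : R := rxS s s' o.1.1 * q o.1.1 o.1.2 o.2.

Definition smp (s1 s2 : S) (o1 o2 : obs) : sample U V W X Y Z :=
  (s1, s2, (o1.1.1, o2.1.1), (o1.1.2, o2.1.2), (o1.2, o2.2)).

Lemma q_ge0 x y z : 0 <= q x y z.
Proof. by have [h _] := hq x; apply: (h (y, z)). Qed.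

Lemma kapS_pmf s s' : is_pmf (kapS s s').
Proof.
have [rx0 rx1] := hrx s.1.1 s.1.2 s.2 s'.1.1 s'.1.2 s'.2.
split=> [ob|]; first by rewrite mulr_ge0 ?q_ge0// rx0.
rewrite sum_pair sum_pair /kapS /=.
under eq_bigr => x _ do (under eq_bigr do rewrite -mulr_sumr;
  rewrite -mulr_sumr -(sum_pair (fun yz => q x yz.1 yz.2)) (proj2 (hq x)) mulr1).
exact: rx1.
Qed.

(** Expanding [rtilde] brings out the preceding source letter [s0], so the joint pmf is the window
    law of three consecutive source letters with the first summed out. *)
Lemma joint_smp s1 s2 o1 o2 : P (smp s1 s2 o1 o2) =
  \sum_s0 srcP s0 * srcP s1 * srcP s2 * (kapS s0 s1 o1 * kapS s1 s2 o2).
Proof.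
rewrite /joint /rtilde /= mulrAC mulr_sumr.
by apply: eq_bigr => s0 _; rewrite /kapS /srcP /rxS /sU1 /sV1 /sW1 /sU2 /sV2 /sW2
  /sX1 /sX2 /sY1 /sY2 /sZ1 /sZ2 /=; ring.
Qed.

Lemma sum_smp (F : sample U V W X Y Z -> R) :
  \sum_t F t = \sum_s1 \sum_s2 \sum_o1 \sum_o2 F (smp s1 s2 o1 o2).
Proof.
rewrite pair_bigA /= pair_bigA /= pair_bigA /=.
rewrite (reindex (fun t => smp t.1.1.1 t.1.1.2 t.1.2 t.2))//=.
exists (fun t : sample U V W X Y Z =>
  (t.1.1.1.1, t.1.1.1.2, (t.1.1.2.1, t.1.2.1, t.2.1), (t.1.1.2.2, t.1.2.2, t.2.2))).
  by move=> [[[s1 s2] [[x1 y1] z1]] [[x2 y2] z2]].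
by move=> [[[[s1 s2] [x1 x2]] [y1 y2]] [z1 z2]].
Qed.

Lemma windowE_joint (g : sample U V W X Y Z -> R) :
  windowE srcP kapS (fun a b x y => g (smp a b x y)) = \sum_t P t * g t.
Proof.
rewrite sum_smp /windowE exchange_big /=; apply: eq_bigr => s1 _.
rewrite exchange_big /=; apply: eq_bigr => s2 _.
under eq_bigr do rewrite mulr_sumr; rewrite exchange_big /=.
apply: eq_bigr => o1 _; under eq_bigr do rewrite mulr_sumr.
rewrite exchange_big /=; apply: eq_bigr => o2 _.
by rewrite joint_smp mulr_suml; apply: eq_bigr => s0 _; ring.
Qed.

Lemma srcP_pmf : is_pmf srcP. Proof. exact: hr3. Qed.

Lemma path_weight_ge0 s0 s1 s2 o1 o2 :
  0 <= srcP s0 * srcP s1 * srcP s2 * (kapS s0 s1 o1 * kapS s1 s2 o2).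
Proof.
have [r0 _] := srcP_pmf; have k0 a b := proj1 (kapS_pmf a b).
by apply: mulr_ge0; apply: mulr_ge0 => //; apply: mulr_ge0.
Qed.

Lemma joint_pmf : is_pmf P.
Proof.
split=> [t|].
  have -> : t = smp t.1.1.1.1 t.1.1.1.2 (t.1.1.2.1, t.1.2.1, t.2.1) (t.1.1.2.2, t.1.2.2, t.2.2).
    by case: t => [[[[s1 s2] [x1 x2]] [y1 y2]] [z1 z2]].
  rewrite joint_smp; apply: sumr_ge0 => s0 _.
  exact: path_weight_ge0.
have := windowE_joint (fun=> 1); rewrite -mulr_suml mulr1 => <-.
(* The total mass is the window mean of 1; it is obtained by centering 1 at 1, which gives the mean
   of 0. *)
have := windowEB srcP_pmf kapS_pmf (fun _ _ _ _ => 1) 1.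
rewrite subrr (_ : windowE _ _ _ = 0); first by lra.
rewrite /windowE big1// => a _; rewrite big1// => b _; rewrite big1// => c _.
by rewrite big1 ?mulr0// => x _; rewrite big1// => y _; rewrite mulr0.
Qed.

Lemma joint_gt0 a b c x y : 0 < srcP a -> 0 < srcP b -> 0 < srcP c ->
  0 < kapS a b x -> 0 < kapS b c y -> 0 < P (smp b c x y).
Proof.
move=> pa pb pc px py; rewrite joint_smp (bigD1 a)//=; apply: ltr_pwDl.
  by apply: mulr_gt0; apply: mulr_gt0 => //; apply: mulr_gt0.
apply: sumr_ge0 => s0 _.
exact: path_weight_ge0.
Qed.

Lemma marg_src s : marg P (fun t => (sU2 t, sV2 t, sW2 t)) s = srcP s.
Proof.
have := windowE_joint (fun t => (((sU2 t, sV2 t, sW2 t) == s)%:R : R)).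
rewrite -(sum_marg P (fun t => (sU2 t, sV2 t, sW2 t)) (fun a => (a == s)%:R)).
rewrite (bigD1 s)//= eqxx mulr1 [X in _ + X]big1 ?addr0 => [<-|a /negbTE ->]; last by rewrite mulr0.
have r1 := proj2 srcP_pmf; have k1 a b := proj2 (kapS_pmf a b).
have inner a b c : \sum_x \sum_y kapS a b x * kapS b c y *
    ((sU2 (smp b c x y), sV2 (smp b c x y), sW2 (smp b c x y)) == s)%:R = (c == s)%:R :> R.
  rewrite /sU2 /sV2 /sW2 /=.
  under eq_bigr do rewrite -mulr_suml -mulr_sumr k1 mulr1.
  by rewrite -mulr_suml k1 mul1r -!surjective_pairing.
rewrite /windowE.
under eq_bigr do under eq_bigr do under eq_bigr do rewrite inner.
have last a b : \sum_c srcP a * srcP b * srcP c * (c == s)%:R = srcP a * srcP b * srcP s.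
  rewrite (bigD1 s)//= eqxx mulr1 big1 ?addr0// => c /negbTE ->.
  by rewrite mulr0.
under eq_bigr do under eq_bigr do rewrite last.
under eq_bigr do rewrite -mulr_suml -mulr_sumr r1 mulr1.
by rewrite -mulr_suml r1 mul1r.
Qed.

Notation TT := (sample U V W X Y Z).
Notation vU2 := (@sU2 U V W X Y Z).
Notation vV2 := (@sV2 U V W X Y Z).
Notation vW2 := (@sW2 U V W X Y Z).
Definition vU2W2 (t : TT) := (sU2 t, sW2 t).
Definition vV2W2 (t : TT) := (sV2 t, sW2 t).
Definition vYctx (t : TT) := (sY1 t, sY2 t, sU1 t, sW1 t).
Definition vZctx (t : TT) := (sZ1 t, sZ2 t, sV1 t, sW1 t).

(** * Block laws and densities for k + 2 source letters and k + 1 channel uses *)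

Section Block.
Variable k : nat.
Notation seqn A := {ffun 'I_k.+2 -> A}.
Notation seqm A := {ffun 'I_k.+1 -> A}.

Definition pWn (w : seqn W) : R := \prod_i marg P vW2 (w i).
Definition pUn (w : seqn W) (u : seqn U) : R := \prod_i cond P vU2 vW2 (w i) (u i).
Definition pVn (w : seqn W) (v : seqn V) : R := \prod_i cond P vV2 vW2 (w i) (v i).
Definition rhon (u : seqn U) (v : seqn V) (w : seqn W) : R :=
  \prod_i cdens P vU2 vV2 vW2 (u i) (v i) (w i).
Definition kxn (u : seqn U) (v : seqn V) (w : seqn W) (x : seqm X) : R :=
  \prod_(i < k.+1) rxS (u (inord i), v (inord i), w (inord i))
    (u (inord i.+1), v (inord i.+1), w (inord i.+1)) (x i).
Definition Qn (x : seqm X) (y : seqm Y) (z : seqm Z) : R :=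
  \prod_i q (x i) (y i) (z i).

(** Letter [j.+2] is tested against its two outputs and the previous letter; the first two letters
    have no full context and are not tested. This version is for competitors in other clouds, the
    primed one, conditional on [w], for those in the sent cloud. *)
Definition D1n (u : seqn U) (w : seqn W) (y : seqm Y) : R :=
  \prod_(j < k) mdens P vU2W2 vYctx (u (inord j.+2), w (inord j.+2))
    (y (inord j), y (inord j.+1), u (inord j.+1), w (inord j.+1)).
Definition D1n' (u : seqn U) (w : seqn W) (y : seqm Y) : R :=
  \prod_(j < k) cdens P vU2 vYctx vW2 (u (inord j.+2))
    (y (inord j), y (inord j.+1), u (inord j.+1), w (inord j.+1)) (w (inord j.+2)).
Definition D2n (v : seqn V) (w : seqn W) (z : seqm Z) : R :=
  \prod_(j < k) mdens P vV2W2 vZctx (v (inord j.+2), w (inord j.+2))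
    (z (inord j), z (inord j.+1), v (inord j.+1), w (inord j.+1)).
Definition D2n' (v : seqn V) (w : seqn W) (z : seqm Z) : R :=
  \prod_(j < k) cdens P vV2 vZctx vW2 (v (inord j.+2))
    (z (inord j), z (inord j.+1), v (inord j.+1), w (inord j.+1)) (w (inord j.+2)).

Lemma pWn_pmf : is_pmf pWn.
Proof. exact: (prod_pmf (fun=> marg_pmf joint_pmf _)). Qed.

Lemma pUn_pmf w : is_pmf (pUn w).
Proof. exact: (prod_pmf (P := fun i => cond P vU2 vW2 (w i)) (fun i => cond_pmf joint_pmf _ _ _)). Qed.

Lemma pVn_pmf w : is_pmf (pVn w).
Proof. exact: (prod_pmf (P := fun i => cond P vV2 vW2 (w i)) (fun i => cond_pmf joint_pmf _ _ _)). Qed.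

Lemma rhon_ge0 u v w : 0 <= rhon u v w.
Proof. by apply: prodr_ge0 => i _; apply: (cdens_ge0 joint_pmf). Qed.

Lemma kxn_pmf u v w : is_pmf (kxn u v w).
Proof.
exact: (prod_pmf (P := fun i : 'I_k.+1 => rxS (u (inord i), v (inord i), w (inord i))
    (u (inord i.+1), v (inord i.+1), w (inord i.+1))) (fun i => hrx _ _ _ _ _ _)).
Qed.

Lemma Qn_channel : is_channel Qn.
Proof.
move=> x; split=> [yz|]; first by apply: prodr_ge0 => i _; apply: q_ge0.
rewrite sum_pair /= sum_ffun_pair /Qn.
under eq_bigr do under eq_bigr do rewrite !ffunE.
rewrite -(bigA_distr_bigA (fun i yz => q (x i) yz.1 yz.2)) big1// => i _.
by case: (hq (x i)).
Qed.

Lemma rhon_sumU v w : Ex (pUn w) (fun u => rhon u v w) <= 1.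
Proof.
rewrite /Ex /pUn /rhon; under eq_bigr do rewrite -big_split /=.
rewrite -(bigA_distr_bigA (fun i a => cond P vU2 vW2 (w i) a * cdens P vU2 vV2 vW2 a (v i) (w i))).
apply: prodr_ile1 => i _; rewrite (cdens_suml joint_pmf) andbT sumr_ge0// => a _.
by apply: mulr_ge0; [apply: (proj1 (cond_pmf joint_pmf _ _ _))|apply: (cdens_ge0 joint_pmf)].
Qed.

Lemma rhon_sumV u w : Ex (pVn w) (fun v => rhon u v w) <= 1.
Proof.
rewrite /Ex /pVn /rhon; under eq_bigr do rewrite -big_split /=.
rewrite -(bigA_distr_bigA (fun i a => cond P vV2 vW2 (w i) a * cdens P vU2 vV2 vW2 (u i) a (w i))).
apply: prodr_ile1 => i _; rewrite (cdens_sumr joint_pmf) andbT sumr_ge0// => a _.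
by apply: mulr_ge0; [apply: (proj1 (cond_pmf joint_pmf _ _ _))|apply: (cdens_ge0 joint_pmf)].
Qed.

(** Letter by letter, weighting the reference law by the density restores the i.i.d. source law. *)
Lemma triE_rhon (G : seqn U -> seqn V -> seqn W -> R) :
  triE pWn pUn pVn (fun w u v => rhon u v w * G u v w) =
  prodE (fun=> srcP) (fun s => G (ffst (ffst s)) (fsnd (ffst s)) (fsnd s)).
Proof.
transitivity (\sum_u \sum_v \sum_w
    (pWn w * (pUn w u * (pVn w v * rhon u v w))) * G u v w).
  rewrite /triE /Ex; under eq_bigr do rewrite mulr_sumr.
  rewrite exchange_big /=; apply: eq_bigr => u _.
  under eq_bigr do rewrite !mulr_sumr.
  rewrite exchange_big /=; apply: eq_bigr => v _; apply: eq_bigr => w _.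
  by rewrite !mulrA.
rewrite (sum_ffun_pair (fun u v => \sum_w pWn w * (pUn w u * (pVn w v * rhon u v w)) * G u v w)).
rewrite (sum_ffun_pair (fun h w => pWn w * (pUn w (ffst h) * (pVn w (fsnd h) *
  rhon (ffst h) (fsnd h) w)) * G (ffst h) (fsnd h) w)).
apply: eq_bigr => s _; congr (_ * _).
rewrite /pWn /pUn /pVn /rhon -!big_split /=; apply: eq_bigr => i _.
rewrite !ffunE (cond_cdens joint_pmf) marg_src.
by congr srcP; case: (s i) => [[]].
Qed.

Lemma sum_obsn (F : seqm X * seqm Y * seqm Z -> R) :
  \sum_o F o = \sum_(t : seqm obs) F (ffst (ffst t), fsnd (ffst t), fsnd t).
Proof.
rewrite sum_pair sum_pair (sum_ffun_pair (fun x y => \sum_z F (x, y, z))).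
by rewrite (sum_ffun_pair (fun h z => F (ffst h, fsnd h, z))).
Qed.

Lemma rhon_sum : triE pWn pUn pVn (fun w u v => rhon u v w) = 1.
Proof.
transitivity (triE pWn pUn pVn (fun w u v => rhon u v w * 1)).
  by apply: eq_Ex => w; apply: eq_Ex => u; apply: eq_Ex => v; rewrite mulr1.
by rewrite (triE_rhon (fun _ _ _ => 1)) (prodE_cst _ (fun=> srcP_pmf)).
Qed.

(** The factors are not independent, since the context of each letter contains the previous letter
    of the same codeword. They form a chain with [y] as a fixed parameter, so the telescoping bound
    applies. *)
Lemma Ex_D1n y : Ex pWn (fun w => Ex (pUn w) (fun u => D1n u w y)) <= 1.
Proof.
pose B (j : nat) (a b : U * W) := mdens P vU2W2 vYctx b
  ((y (inord j), y (inord j.+1), a.1), a.2).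
have hm (i : 'I_k.+2) : is_pmf (marg P vU2W2) by apply: (marg_pmf joint_pmf).
apply: le_trans (@prodE_chain_le1 R _ k (fun=> marg P vU2W2) B hm _ _ k (leqnn k)).
- rewrite /Ex; under eq_bigr do rewrite mulr_sumr; rewrite exchange_big /=.
  rewrite (sum_ffun_pair (fun u w => pWn w * (pUn w u * D1n u w y))).
  rewrite /prodE; apply: ler_sum => h _.
  rewrite mulrA /pWn /pUn -big_split /= /D1n /chain big_mkord le_eqVlt.
  apply/orP; left; apply/eqP; congr (_ * _).
    apply: eq_bigr => i _; rewrite !ffunE (marg_cond joint_pmf).
    by case: (h i).
  by apply: eq_bigr => j _; rewrite !ffunE /B; case: (h (inord j.+2)).
- by move=> j a b; apply: (mdens_ge0 joint_pmf).
- by move=> j a _; apply: (mdens_sum joint_pmf).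
Qed.

(** Here [w] is fixed as well, so the chain runs over [u] alone, with a letter law that depends on
    the position. *)
Lemma Ex_D1n' w y : Ex (pUn w) (fun u => D1n' u w y) <= 1.
Proof.
pose B (j : nat) (a b : U) := cdens P vU2 vYctx vW2 b
  (y (inord j), y (inord j.+1), a, w (inord j.+1)) (w (inord j.+2)).
have hm (i : 'I_k.+2) : is_pmf (cond P vU2 vW2 (w i)) by apply: (cond_pmf joint_pmf).
apply: le_trans (@prodE_chain_le1 R _ k (fun i => cond P vU2 vW2 (w i)) B hm _ _ k (leqnn k)).
- by rewrite /prodE; apply: ler_sum => h _; rewrite /chain big_mkord.
- by move=> j a b; apply: (cdens_ge0 joint_pmf).
- by move=> j a _; apply: (cdens_suml joint_pmf).
Qed.

Lemma Ex_D2n z : Ex pWn (fun w => Ex (pVn w) (fun v => D2n v w z)) <= 1.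
Proof.
pose B (j : nat) (a b : V * W) := mdens P vV2W2 vZctx b
  ((z (inord j), z (inord j.+1), a.1), a.2).
have hm (i : 'I_k.+2) : is_pmf (marg P vV2W2) by apply: (marg_pmf joint_pmf).
apply: le_trans (@prodE_chain_le1 R _ k (fun=> marg P vV2W2) B hm _ _ k (leqnn k)).
- rewrite /Ex; under eq_bigr do rewrite mulr_sumr; rewrite exchange_big /=.
  rewrite (sum_ffun_pair (fun u w => pWn w * (pVn w u * D2n u w z))).
  rewrite /prodE; apply: ler_sum => h _.
  rewrite mulrA /pWn /pVn -big_split /= /D2n /chain big_mkord le_eqVlt.
  apply/orP; left; apply/eqP; congr (_ * _).
    apply: eq_bigr => i _; rewrite !ffunE (marg_cond joint_pmf).
    by case: (h i).
  by apply: eq_bigr => j _; rewrite !ffunE /B; case: (h (inord j.+2)).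
- by move=> j a b; apply: (mdens_ge0 joint_pmf).
- by move=> j a _; apply: (mdens_sum joint_pmf).
Qed.

Lemma Ex_D2n' w z : Ex (pVn w) (fun v => D2n' v w z) <= 1.
Proof.
pose B (j : nat) (a b : V) := cdens P vV2 vZctx vW2 b
  (z (inord j), z (inord j.+1), a, w (inord j.+1)) (w (inord j.+2)).
have hm (i : 'I_k.+2) : is_pmf (cond P vV2 vW2 (w i)) by apply: (cond_pmf joint_pmf).
apply: le_trans (@prodE_chain_le1 R _ k (fun i => cond P vV2 vW2 (w i)) B hm _ _ k (leqnn k)).
- by rewrite /prodE; apply: ler_sum => h _; rewrite /chain big_mkord.
- by move=> j a b; apply: (cdens_ge0 joint_pmf).
- by move=> j a _; apply: (cdens_suml joint_pmf).
Qed.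

End Block.
End NLetter.

Arguments pWn {R U V W X Y Z} q r3 rx {k}.
Arguments pUn {R U V W X Y Z} q r3 rx {k}.
Arguments pVn {R U V W X Y Z} q r3 rx {k}.
Arguments rhon {R U V W X Y Z} q r3 rx {k}.
Arguments kxn {R U V W X} rx {k}.
Arguments Qn {R X Y Z} q {k}.

(** * Indicator bounds and the existence of block codes *)

Lemma markov_indicator (R : realType) (b : bool) (g x : R) :
  0 < g -> 0 <= x -> (b -> g <= x) -> b%:R <= g^-1 * x.
Proof.
move=> g0 x0 h; case: b h => [/(_ isT) gx|_]; last by rewrite mulr_ge0// invr_ge0 ltW.
by rewrite mulrC ler_pdivlMr// mul1r.
Qed.

Lemma union_indicator (R : realType) (b b0 b1 b2 b3 b4 : bool) :
  (b0 -> b1 -> b2 -> b3 -> b4 -> b) ->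
  (~~ b)%:R <= (~~ b0)%:R + (~~ b1)%:R + (~~ b2)%:R + (~~ b3)%:R + (~~ b4)%:R :> R.
Proof.
move=> h; rewrite -!natrD ler_nat; move: h.
by case: b0; case: b1; case: b2; case: b3; case: b4; case: b => // /(_ isT isT isT isT isT).
Qed.

Section BlockCode.
Variables (R : realType) (U V W X Y Z : finType).
Variables (q : X -> Y -> Z -> R) (r3 : U -> V -> W -> R).
Variable rx : U -> V -> W -> U -> V -> W -> X -> R.
Hypothesis hq : is_channel q.
Hypothesis hr3 : is_pmf (fun a : U * V * W => r3 a.1.1 a.1.2 a.2).
Hypothesis hrx : forall u1 v1 w1 u2 v2 w2, is_pmf (rx u1 v1 w1 u2 v2 w2).
Notation P := (joint q r3 rx).
Notation TT := (sample U V W X Y Z).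
Notation vU2 := (@sU2 U V W X Y Z).
Notation vV2 := (@sV2 U V W X Y Z).
Notation vW2 := (@sW2 U V W X Y Z).
Notation vA := (@vU2W2 U V W X Y Z).
Notation vB := (@vV2W2 U V W X Y Z).
Notation vY := (@vYctx U V W X Y Z).
Notation vZ := (@vZctx U V W X Y Z).
Notation S := (U * V * W)%type.
Notation obs := (X * Y * Z)%type.
Let hP : is_pmf P := joint_pmf hq hr3 hrx.
Let hS : is_pmf (srcP r3) := srcP_pmf hr3.
Let hK : forall s s', is_pmf (kapS q rx s s') := kapS_pmf hq hrx.

(** Under the change of measure a block is a source path with its outputs, which makes the law of
    large numbers available for [fail_prob]. *)
Lemma fail_prob_pathE k phi1 phi2 (g0 : R) :
  fail_prob (pWn q r3 rx (k := k)) (pUn q r3 rx) (pVn q r3 rx)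
    (rhon q r3 rx) (kxn rx) (Qn q) phi1 phi2 g0 =
  pathE (srcP r3) (kapS q rx) (fun s t => (~~ good (rhon q r3 rx) phi1 phi2 g0
    (ffst (ffst s)) (fsnd (ffst s)) (fsnd s)
    (ffst (ffst t), fsnd (ffst t), fsnd t))%:R).
Proof.
rewrite /fail_prob (triE_rhon hq hr3 hrx) /pathE; apply: eq_prodE => s.
rewrite sum_obsn /prodE; apply: eq_bigr => t _; congr (_ * _).
rewrite /obsP /kxn /Qn -big_split /=; apply: eq_bigr => i _.
by rewrite !ffunE /stepP /kapS; case: (s (inord i)) => [[]]; case: (s (inord i.+1)) => [[]].
Qed.

(** The density [rhon] has [k.+2] factors while the law of large numbers sees only the last [k]; the
    first two cost a constant. *)
Lemma prod_first_two (k : nat) (F : 'I_k.+2 -> R) (B : R) :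
  (forall i, 0 <= F i <= B) ->
  \prod_i F i <= B ^+ 2 * \prod_(j < k) F (inord j.+2).
Proof.
move=> hF; rewrite 2!big_ord_recl /= mulrA.
have h (j : 'I_k) : lift ord0 (lift ord0 j) = inord j.+2 :> 'I_k.+2.
  by apply: val_inj; rewrite /= inordK//; have := ltn_ord j; lia.
under eq_bigr do rewrite h.
apply: ler_wpM2r; first by apply: prodr_ge0 => j _; case/andP: (hF (inord j.+2)).
by rewrite expr2; apply: ler_pM; case/andP: (hF ord0) => // *; case/andP: (hF (lift ord0 ord0)).
Qed.

Let A := minfo P vA vY.
Let A' := cminfo P vU2 vY vW2.
Let B := minfo P vB vZ.
Let B' := cminfo P vV2 vZ vW2.
Let C := cminfo P vU2 vV2 vW2.

(** The one-shot bound with thresholds at [exp(k (I - d))] for the decoders and [exp(k (C + d))], up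
    to a constant, for the encoder. The constant [c] depends neither on [k] nor on the index
    sets. *)
Lemma block_code (d : R) : 0 < d -> exists c : R, 0 <= c /\
  forall (k : nat) (M K1 L1 K2 L2 T : finType) (t0 : T)
    (mm : T -> M) (kk1 : T -> K1) (kk2 : T -> K2),
  (0 < k)%N -> (0 < #|L1|)%N -> (0 < #|L2|)%N ->
  exists (enc : T -> {ffun 'I_k.+1 -> X}) (d1 : {ffun 'I_k.+1 -> Y} -> M * K1)
    (d2 : {ffun 'I_k.+1 -> Z} -> M * K2),
  #|T|%:R * (1 - (c / k%:R + c * expR (k%:R * (C + d)) / (#|L1| * #|L2|)%N%:R
    + #|L1|%:R * (#|M|%:R * #|K1|%:R * (expR (k%:R * (A - d)))^-1
        + (#|K1|%:R - 1) * (expR (k%:R * (A' - d)))^-1)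
    + #|L2|%:R * (#|M|%:R * #|K2|%:R * (expR (k%:R * (B - d)))^-1
        + (#|K2|%:R - 1) * (expR (k%:R * (B' - d)))^-1))) <=
  \sum_t \sum_(y : {ffun 'I_k.+1 -> Y}) \sum_(z : {ffun 'I_k.+1 -> Z})
    (\prod_(i < k.+1) q (enc t i) (y i) (z i)) *
    ((d1 y == (mm t, kk1 t))%:R * (d2 z == (mm t, kk2 t))%:R).
Proof.
move=> d0.
(* Each information density is a window function of the path, and its mean logarithm is the
   corresponding information. *)
have tail (dn : TT -> R) (m : R) : (forall t, 0 < P t -> 0 < dn t) ->
    m = \sum_t P t * ln (dn t) ->
    exists c : R, 0 <= c /\ forall k, (0 < k)%N ->
    pathE (srcP r3) (kapS q rx) (fun (s : {ffun 'I_k.+2 -> S}) t => (~~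
      (expR (k%:R * (m - d)) <= \prod_(j < k) window (fun a b x y => dn (smp a b x y)) j s t <=
       expR (k%:R * (m + d)))%R)%:R) <= c / k%:R.
  move=> dpos ->; rewrite -windowE_joint.
  apply: (density_tail hS hK (D := fun a b x y => dn (smp a b x y)) d0).
  by move=> a b c x y *; apply: dpos; apply: (joint_gt0 hq hr3 hrx (a := a)).
have [c0 [c00 t0]] := tail _ _ (cdens_gt0 hP vU2 vV2 vW2) (cminfoE hP _ _ _).
have [c1 [c10 t1]] := tail _ _ (mdens_gt0 hP vA vY) (minfoE hP _ _).
have [c2 [c20 t2]] := tail _ _ (cdens_gt0 hP vU2 vY vW2) (cminfoE hP _ _ _).
have [c3 [c30 t3]] := tail _ _ (mdens_gt0 hP vB vZ) (minfoE hP _ _).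
have [c4 [c40 t4]] := tail _ _ (cdens_gt0 hP vV2 vZ vW2) (cminfoE hP _ _ _).
pose D := \sum_(s : S) cdens P vU2 vV2 vW2 s.1.1 s.1.2 s.2.
have hD u v w : cdens P vU2 vV2 vW2 u v w <= D.
  rewrite /D (bigD1 (u, v, w))//= lerDl sumr_ge0// => s _; exact: (cdens_ge0 hP).
pose ct := 2 * (c0 + c1 + c2 + c3 + c4).
have ct0 : 0 <= ct by rewrite /ct; lra.
(* A single constant for two purposes: [ct] covers the five tails, doubled as in [err_bound], and
   [D ^+ 2] the two extra letters in [g0]. *)
exists (ct + D ^+ 2); split; first by rewrite addr_ge0// sqr_ge0.
move=> k M K1 L1 K2 L2 T tt mm kk1 kk2 k0 L1p L2p.
pose g1 := expR (k%:R * (A - d)); pose g1' := expR (k%:R * (A' - d)).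
pose g2 := expR (k%:R * (B - d)); pose g2' := expR (k%:R * (B' - d)).
pose g0 := D ^+ 2 * expR (k%:R * (C + d)).
pose phi1 u w y := (g1 <= D1n (k := k) q r3 rx u w y) && (g1' <= D1n' q r3 rx u w y).
pose phi2 v w z := (g2 <= D2n (k := k) q r3 rx v w z) && (g2' <= D2n' q r3 rx v w z).
have W0 := proj1 (pWn_pmf hq hr3 hrx k).
have U0 w := proj1 (pUn_pmf hq hr3 hrx (k := k) w).
have V0 w := proj1 (pVn_pmf hq hr3 hrx (k := k) w).
have D1n0 u w y : 0 <= D1n (k := k) q r3 rx u w y.
  by apply: prodr_ge0 => j _; apply: (mdens_ge0 hP).
have D1n'0 u w y : 0 <= D1n' (k := k) q r3 rx u w y.
  by apply: prodr_ge0 => j _; apply: (cdens_ge0 hP).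
have D2n0 u w y : 0 <= D2n (k := k) q r3 rx u w y.
  by apply: prodr_ge0 => j _; apply: (mdens_ge0 hP).
have D2n'0 u w y : 0 <= D2n' (k := k) q r3 rx u w y.
  by apply: prodr_ge0 => j _; apply: (cdens_ge0 hP).
have E1 y : Ex (pWn q r3 rx) (fun w => Ex (pUn q r3 rx w) (fun u => (phi1 u w y)%:R)) <= g1^-1.
  rewrite -[leRHS]mulr1.
  apply: le_trans (ler_wpM2l _ (Ex_D1n hq hr3 hrx y)); last by rewrite invr_ge0 expR_ge0.
  rewrite -ExZ; apply: le_Ex => // w; rewrite -ExZ; apply: le_Ex => // u.
  by apply: markov_indicator; rewrite ?expR_gt0// => /andP[].
have E1' w y : Ex (pUn q r3 rx w) (fun u => (phi1 u w y)%:R) <= g1'^-1.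
  rewrite -[leRHS]mulr1.
  apply: le_trans (ler_wpM2l _ (Ex_D1n' hq hr3 hrx w y)); last by rewrite invr_ge0 expR_ge0.
  rewrite -ExZ; apply: le_Ex => // u.
  by apply: markov_indicator; rewrite ?expR_gt0// => /andP[].
have E2 z : Ex (pWn q r3 rx) (fun w => Ex (pVn q r3 rx w) (fun v => (phi2 v w z)%:R)) <= g2^-1.
  rewrite -[leRHS]mulr1.
  apply: le_trans (ler_wpM2l _ (Ex_D2n hq hr3 hrx z)); last by rewrite invr_ge0 expR_ge0.
  rewrite -ExZ; apply: le_Ex => // w; rewrite -ExZ; apply: le_Ex => // v.
  by apply: markov_indicator; rewrite ?expR_gt0// => /andP[].
have E2' w z : Ex (pVn q r3 rx w) (fun v => (phi2 v w z)%:R) <= g2'^-1.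
  rewrite -[leRHS]mulr1.
  apply: le_trans (ler_wpM2l _ (Ex_D2n' hq hr3 hrx w z)); last by rewrite invr_ge0 expR_ge0.
  rewrite -ExZ; apply: le_Ex => // v.
  by apply: markov_indicator; rewrite ?expR_gt0// => /andP[].
have g00 : 0 <= g0 by rewrite mulr_ge0 ?sqr_ge0 ?expR_ge0.
have i0 (g : R) : 0 < g -> 0 <= g^-1 by move=> h; rewrite invr_ge0 ltW.
(* The input alphabet is inhabited because it carries a pmf. *)
have [x0 _] : exists _ : {ffun 'I_k.+1 -> X}, True.
  have [s _] := exists_ge_Ex (fun=> 0) hS.
  have [x _] := exists_ge_Ex (fun=> 0) (hrx s.1.1 s.1.2 s.2 s.1.1 s.1.2 s.2).
  by exists [ffun=> x].
have [enc [d1 [d2 H]]] := one_shot (M := M) (K1 := K1) (K2 := K2)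
  (pWn_pmf hq hr3 hrx k) (pUn_pmf hq hr3 hrx (k := k)) (pVn_pmf hq hr3 hrx (k := k))
  (rhon_ge0 hq hr3 hrx (k := k)) (rhon_sumU hq hr3 hrx (k := k)) (rhon_sumV hq hr3 hrx (k := k))
  (rhon_sum hq hr3 hrx k) (kxn_pmf hrx (k := k)) (Qn_channel hq (k := k)) E1 E1' E2 E2' g00
  (i0 _ (expR_gt0 _)) (i0 _ (expR_gt0 _)) (i0 _ (expR_gt0 _)) (i0 _ (expR_gt0 _)) L1p L2p
  x0 tt mm kk1 kk2.
exists enc, d1, d2; apply: le_trans H; apply: ler_wpM2l => //; rewrite lerD2l lerN2 /err_bound.
set fp := fail_prob _ _ _ _ _ _ _ _ _.
have hfp : fp <= (c0 + c1 + c2 + c3 + c4) / k%:R.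
  rewrite /fp fail_prob_pathE !mulrDl.
  apply: le_trans (lerD (lerD (lerD (lerD (t0 k k0) (t1 k k0)) (t2 k k0)) (t3 k k0)) (t4 k k0)).
  rewrite -!pathED; apply: le_pathE => // s t.
  (* The upper estimate serves the cutoff on [rho], the lower estimates serve the four decoding
     thresholds. *)
  apply: union_indicator => /andP[_ b0] /andP[b1 _] /andP[b2 _] /andP[b3 _] /andP[b4 _].
  apply/and3P; split; [|apply/andP; split|apply/andP; split].
  - apply: le_trans (prod_first_two (B := D) _) _.
      by move=> i; rewrite (cdens_ge0 hP) hD.
    rewrite /g0 ler_wpM2l ?sqr_ge0//; apply: le_trans b0.
    by apply: ler_prod => j _; rewrite !ffunE lexx andbT; apply: (cdens_ge0 hP).
  - by apply: le_trans b1 _; apply: ler_prod => j _; rewrite !ffunE lexx andbT; apply: (mdens_ge0 hP).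
  - by apply: le_trans b2 _; apply: ler_prod => j _; rewrite !ffunE lexx andbT; apply: (cdens_ge0 hP).
  - by apply: le_trans b3 _; apply: ler_prod => j _; rewrite !ffunE lexx andbT; apply: (mdens_ge0 hP).
  - by apply: le_trans b4 _; apply: ler_prod => j _; rewrite !ffunE lexx andbT; apply: (cdens_ge0 hP).
have kR : 0 < k%:R :> R by rewrite ltr0n.
have h1 : 2 * fp <= ct / k%:R by rewrite /ct -mulrA ler_wpM2l.
have h2 : 0 <= D ^+ 2 / k%:R by rewrite divr_ge0 ?sqr_ge0// ltW.
have h3 : 0 <= ct * expR (k%:R * (C + d)) / (#|L1| * #|L2|)%N%:R.
  by apply: mulr_ge0; [apply: mulr_ge0 => //; apply: expR_ge0|rewrite invr_ge0].
rewrite /g0 -/g1 -/g1' -/g2 -/g2' !(mulrDl ct); lra.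
Qed.

End BlockCode.

(** * Rate splitting and sizes of message sets *)

Section Rates.
Variable R : realType.
Implicit Types x a b l : R.

(** Elimination of one variable having a weak and a strict bound on each side. *)
Lemma pick_between (lo0 lo hi0 hi : R) : lo0 <= hi0 -> lo0 < hi -> lo < hi0 -> lo < hi ->
  exists x, [/\ lo0 <= x, lo < x, x <= hi0 & x < hi].
Proof.
move=> h1 h2 h3 h4; have [lt|ge] := ltP lo lo0; first by exists lo0.
have : lo < Num.min hi0 hi by rewrite lt_min h3.
have : Num.min hi0 hi <= hi0 by rewrite ge_min lexx.
have : Num.min hi0 hi <= hi by rewrite ge_min lexx orbT.
by move=> *; exists ((lo + Num.min hi0 hi) / 2); split; lra.
Qed.

Lemma pick_pair (p q C : R) : 0 < p -> 0 < q -> C < p + q ->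
  exists l1 l2, [/\ 0 <= l1, 0 <= l2, l1 < p, l2 < q & C < l1 + l2].
Proof.
move=> p0 q0 pq.
have [l1 [? lo ? ?]] : exists l1, [/\ 0 <= l1, C - q < l1, l1 <= p & l1 < p].
  by apply: pick_between; lra.
have [l2 [? lo2 ? ?]] : exists l2, [/\ 0 <= l2, C - l1 < l2, l2 <= q & l2 < q].
  by apply: pick_between; lra.
by exists l1, l2; split => //; lra.
Qed.

(** Private rate [Ri] splits into [ai], carried by the cloud center, and [bi], carried by the
    satellite; [li] is the bin rate. The alternative [bi = 0] reflects that a single satellite index
    has no competitor in its own cloud. *)
Definition splittable (R0 R1 R2 A A' B B' C : R) : Prop :=
  exists a1 b1 a2 b2 l1 l2,
  [/\ [/\ 0 <= a1, 0 <= b1, 0 <= a2 & 0 <= b2], 0 <= l1 /\ 0 <= l2,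
      R1 = a1 + b1 /\ R2 = a2 + b2, C < l1 + l2 &
      [/\ b1 = 0 \/ b1 + l1 < A', b2 = 0 \/ b2 + l2 < B',
          R0 + a1 + a2 + b1 + l1 < A & R0 + a1 + a2 + b2 + l2 < B]].

Lemma splittableC (R0 R1 R2 A A' B B' C : R) :
  splittable R0 R2 R1 B B' A A' C -> splittable R0 R1 R2 A A' B B' C.
Proof.
move=> [a1 [b1 [a2 [b2 [l1 [l2 [[? ? ? ?] [? ?] [? ?] ? [? ? ? ?]]]]]]]].
by exists a2, b2, a1, b1, l2, l1; split; [split|split|split| |split] => //; lra.
Qed.

(* When [b1 = 0] receiver 1 has nothing to learn from its satellite, so [A'] puts no
   constraint on [l1]. *)
Lemma splittable_degenerate (R0 R1 R2 A B B' C : R) :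
  0 <= R0 -> 0 <= R1 -> 0 <= R2 -> 0 < B' -> 0 <= C ->
  R0 + R1 < A -> R0 + R2 < B ->
  R0 + R1 + R2 < B' + A - C -> R0 + R1 + R2 < B - C ->
  splittable R0 R1 R2 A 0 B B' C.
Proof.
move=> R00 R10 R20 B0 C0 hA hB h3 h4.
have [a2 [? ? ? ]] : exists a2, [/\ 0 <= a2, R2 - B' < a2, a2 <= R2 &
    a2 < Num.min (A - R0 - R1) (A + B - C - 2 * R0 - 2 * R1 - R2)].
  by apply: pick_between; rewrite ?lt_min; try (apply/andP; split); lra.
rewrite lt_min => /andP[? ?].
have [l1 [l2 []]] : exists l1 l2, [/\ 0 <= l1, 0 <= l2, l1 < A - R0 - R1 - a2,
    l2 < Num.min (B' - R2 + a2) (B - R0 - R1 - R2) & C < l1 + l2].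
  apply: pick_pair; rewrite ?lt_min; try (apply/andP; split); try lra.
  by rewrite -ltrBlDl lt_min; apply/andP; split; lra.
rewrite lt_min => ? ? ? /andP[? ?] ?.
by exists R1, 0, a2, (R2 - a2), l1, l2; split; [split|split|split| |split]; lra.
Qed.

(* Fourier-Motzkin elimination of the rate-splitting variables of Marton's scheme. *)
Lemma rates_splittable (R0 R1 R2 A A' B B' C : R) :
  0 <= R0 -> 0 <= R1 -> 0 <= R2 -> 0 <= A' -> 0 <= B' -> 0 <= C ->
  R0 + R1 < A -> R0 + R2 < B ->
  R0 + R1 + R2 < B' + A - C -> R0 + R1 + R2 < A' + B - C ->
  2 * R0 + R1 + R2 < A + B - C ->
  splittable R0 R1 R2 A A' B B' C.
Proof.
move=> R00 R10 R20 A'0 B'0 C0 hA hB h3 h4 h5.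
(* When [A' + B' <= C] satellites bring no gain, and the private messages go entirely into the cloud
   centers. *)
have [le|gt] := leP (A' + B') C.
  have [l1 [l2 [? ? ? ? ?]]] : exists l1 l2, [/\ 0 <= l1, 0 <= l2,
      l1 < A - R0 - R1 - R2, l2 < B - R0 - R1 - R2 & C < l1 + l2].
    by apply: pick_pair; lra.
  by exists R1, 0, R2, 0, l1, l2; split; [split|split|split| |split]; lra.
have [A'e|A'n] := eqVneq A' 0.
  by rewrite A'e; apply: splittable_degenerate => //; lra.
have [B'e|B'n] := eqVneq B' 0.
  apply: splittableC; rewrite B'e.
  have A'p : 0 < A' by rewrite lt_neqAle eq_sym A'n.
  by apply: splittable_degenerate => //; lra.
have A'p : 0 < A' by rewrite lt_neqAle eq_sym A'n.
have B'p : 0 < B' by rewrite lt_neqAle eq_sym B'n.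
(* These bound [a1 + a2] from below and above. Comparing [C < l1 + l2] with the two satellite
   constraints gives [L]; comparing it with the two constraints involving [A] and [B] gives [H]. *)
pose L := C - A' - B' + R1 + R2; pose H := A + B - C - 2 * R0 - R1 - R2.
have [a1 [? + ? ]] : exists a1, [/\ 0 <= a1,
    Num.max (R1 - A') (Num.max (L - R2) (L - A + R0 + R1)) < a1, a1 <= R1 &
    a1 < Num.min (B - R0 - R2) (Num.min H (H - R2 + B'))].
  by apply: pick_between; rewrite ?lt_min ?gt_max /L /H; lra.
rewrite !gt_max !lt_min => /andP[? /andP[? ?]] /andP[? /andP[? ?]].
have [a2 [? + ? ]] : exists a2, [/\ 0 <= a2, Num.max (R2 - B') (L - a1) < a2, a2 <= R2 &
    a2 < Num.min (A - R0 - R1) (H - a1)].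
  apply: pick_between; rewrite ?lt_min ?gt_max; unfold L, H in *; lra.
rewrite !gt_max !lt_min => /andP[? ?] /andP[? ?].
have [l1 [l2 []]] : exists l1 l2, [/\ 0 <= l1, 0 <= l2,
    l1 < Num.min (A' - R1 + a1) (A - R0 - R1 - a2),
    l2 < Num.min (B' - R2 + a2) (B - R0 - R2 - a1) & C < l1 + l2].
  unfold L, H in *.
  apply: pick_pair; rewrite ?lt_min; try lra.
  by rewrite -ltrBlDl lt_min !(ltrBlDl, ltrBlDr); rewrite -!ltrBlDr !lt_min; lra.
rewrite !lt_min => ? ? /andP[? ?] /andP[? ?] ?.
by exists a1, (R1 - a1), a2, (R2 - a2), l1, l2; split; [split|split|split| |split]; lra.
Qed.

Lemma ceil_expR_ge0 x : 0 <= Num.ceil (expR x).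
Proof. by rewrite ceil_ge0 (lt_le_trans _ (expR_ge0 _))// ltrN10. Qed.

Lemma msg_size_ge n x : expR (n%:R * x) <= (msg_size n x)%:R.
Proof. by rewrite /msg_size natr_absz ger0_norm ?ceil_expR_ge0// ceil_ge. Qed.

Lemma msg_size_le n x : (msg_size n x)%:R - 1 <= expR (n%:R * x).
Proof.
rewrite /msg_size natr_absz ger0_norm ?ceil_expR_ge0//.
by have := ceilB1_lt (expR (n%:R * x)); rewrite intrB => /ltW.
Qed.

Lemma msg_size_gt0 n x : (0 < msg_size n x)%N.
Proof. by rewrite -(ltr0n R); apply: lt_le_trans (msg_size_ge n x); apply: expR_gt0. Qed.

Lemma msg_size_le2 n x : 0 <= x -> (msg_size n x)%:R <= 2 * expR (n%:R * x).
Proof.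
move=> x0; have := msg_size_le n x.
have : 1 <= expR (n%:R * x) by rewrite -expR0 ler_expR mulr_ge0.
lra.
Qed.

Lemma msg_size0 n : msg_size n (0 : R) = 1%N.
Proof.
by rewrite /msg_size mulr0 expR0 ceil1.
Qed.

(** This makes room for an injection of a message set into the product of its two parts. *)
Lemma msg_size_add n a b : (msg_size n (a + b) <= msg_size n a * msg_size n b)%N.
Proof.
rewrite {1}/msg_size -lez_nat gez0_abs ?ceil_expR_ge0// ceil_le_int -pmulrn.
by rewrite mulrDr expRD natrM; apply: ler_pM; rewrite ?expR_ge0 ?msg_size_ge.
Qed.

(** There are [k.+1] channel uses but only [k] tested letters, whence the factor [expR s]. Of the
    margin [2 * d], one [d] is taken by the threshold and the other leaves
    [exp(-k d) <= 1 / (k d)]. *)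
Lemma expR_decay (k : nat) (d s x : R) : (0 < k)%N -> 0 < d -> s + 2 * d <= x ->
  expR (k.+1%:R * s) * (expR (k%:R * (x - d)))^-1 <= expR s / d / k%:R.
Proof.
move=> k0 d0 sx; have kR : 0 < k%:R :> R by rewrite ltr0n.
rewrite -expRN -expRD.
apply: (@le_trans _ _ (expR (s + - (k%:R * d)))).
  by rewrite ler_expR -natr1 mulrDl mul1r; nra.
rewrite expRD expRN -mulrA ler_wpM2l ?expR_ge0// -invfM lef_pV2 ?posrE ?expR_gt0 ?mulr_gt0//.
by have := expR_ge1Dx (k%:R * d); nra.
Qed.

(** Rounding up costs a factor 2 per message set, hence [32] for five of them. In the second term
    only the bin size is doubled, as the [- 1] absorbs the rounding of the satellite size. *)
Lemma receiver_term_le (k : nat) (R0 a1 a2 b l A A' d : R) : (0 < k)%N -> 0 < d ->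
  0 <= R0 -> 0 <= a1 -> 0 <= a2 -> 0 <= b -> 0 <= l ->
  R0 + a1 + a2 + b + l + 2 * d <= A -> b = 0 \/ b + l + 2 * d <= A' ->
  (msg_size k.+1 l)%:R * (
      (msg_size k.+1 R0 * msg_size k.+1 a1 * msg_size k.+1 a2)%N%:R * (msg_size k.+1 b)%:R *
        (expR (k%:R * (A - d)))^-1
      + ((msg_size k.+1 b)%:R - 1) * (expR (k%:R * (A' - d)))^-1) <=
  (32 * expR (R0 + a1 + a2 + b + l) / d + 2 * expR (b + l) / d) / k%:R.
Proof.
move=> k0 d0 R00 a10 a20 b0 l0 hA hA'.
have kR : 0 < k%:R :> R by rewrite ltr0n.
rewrite mulrDr [leRHS]mulrDl; apply: lerD.
  have := expR_decay k0 d0 hA.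
  set g := (expR (k%:R * (A - d)))^-1 => hd.
  have g0 : 0 <= g by rewrite invr_ge0 expR_ge0.
  apply: (@le_trans _ _ (32 * (expR (k.+1%:R * (R0 + a1 + a2 + b + l)) * g))); last first.
    by rewrite -!mulrA ler_wpM2l// !mulrA.
  rewrite !mulrDr !expRD !natrM.
  have e x := expR_ge0 (k.+1%:R * x : R).
  have m x (hx : 0 <= x) := msg_size_le2 k.+1 hx.
  have n x : 0 <= (msg_size k.+1 x)%:R :> R by [].
  rewrite !mulrA ler_wpM2r//.
  apply: (@le_trans _ _ ((2 * expR (k.+1%:R * l)) * (2 * expR (k.+1%:R * R0)) *
     (2 * expR (k.+1%:R * a1)) * (2 * expR (k.+1%:R * a2)) * (2 * expR (k.+1%:R * b)))).
    by do 4 (apply: ler_pM => //; last exact: m); rewrite ?mulr_ge0// m.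
  by rewrite le_eqVlt; apply/orP; left; apply/eqP; ring.
have [->|{}hA'] := hA'.
  rewrite msg_size0 subrr mul0r mulr0 divr_ge0 ?divr_ge0// ?mulr_ge0 ?expR_ge0 ?ltW//.
have := expR_decay k0 d0 hA'.
set g := (expR (k%:R * (A' - d)))^-1 => hd.
have g0 : 0 <= g by rewrite invr_ge0 expR_ge0.
apply: (@le_trans _ _ (2 * (expR (k.+1%:R * (b + l)) * g))); last first.
  by rewrite -!mulrA ler_wpM2l// !mulrA.
rewrite mulrDr expRD !mulrA ler_wpM2r//.
have p1 : (msg_size k.+1 l)%:R <= 2 * expR (k.+1%:R * l) := msg_size_le2 k.+1 l0.
have p2 := msg_size_le k.+1 b.
have p3 : 1 <= (msg_size k.+1 b)%:R :> R by rewrite ler1n msg_size_gt0.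
rewrite -mulrA [expR _ * _]mulrC mulrA; apply: ler_pM => //; lra.
Qed.

End Rates.

(** * Assembling the code for the broadcast channel *)

Lemma split_index (S T : finType) (x0 : S) : (#|S| <= #|T|)%N ->
  exists (f : S -> T) (g : T -> S), cancel f g.
Proof.
move=> le; pose f x := enum_val (widen_ord le (enum_rank x)).
have finj : injective f.
  by move=> x y /enum_val_inj/(congr1 val)/= /val_inj/enum_rank_inj.
exists f, (fun y => odflt x0 [pick x | f x == y]) => x.
by case: pickP => [y /eqP/finj //|/(_ x)]; rewrite eqxx.
Qed.

Theorem theorem4 (R : realType) (U V W X Y Z : finType)
  (q : X -> Y -> Z -> R) (hq : is_channel q)
  (r3 : U -> V -> W -> R) (hr3 : is_pmf (fun a : U * V * W => r3 a.1.1 a.1.2 a.2))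
  (rx : U -> V -> W -> U -> V -> W -> X -> R)
  (hrx : forall u1 v1 w1 u2 v2 w2, is_pmf (rx u1 v1 w1 u2 v2 w2))
  (R0 R1 R2 : R) :
  let P := joint q r3 rx in
  let YU1W1 := fun t => (sY1 t, sY2 t, sU1 t, sW1 t) in
  let ZV1W1 := fun t => (sZ1 t, sZ2 t, sV1 t, sW1 t) in
  let U2W2 := fun t => (sU2 t, sW2 t) in
  let V2W2 := fun t => (sV2 t, sW2 t) in
  0 <= R0 -> 0 <= R1 -> 0 <= R2 ->
  R0 + R1 < minfo P U2W2 YU1W1 ->
  R0 + R2 < minfo P V2W2 ZV1W1 ->
  R0 + R1 + R2 < cminfo P (@sV2 U V W X Y Z) ZV1W1 (@sW2 U V W X Y Z)
                 + minfo P U2W2 YU1W1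
                 - cminfo P (@sU2 U V W X Y Z) (@sV2 U V W X Y Z) (@sW2 U V W X Y Z) ->
  R0 + R1 + R2 < cminfo P (@sU2 U V W X Y Z) YU1W1 (@sW2 U V W X Y Z)
                 + minfo P V2W2 ZV1W1
                 - cminfo P (@sU2 U V W X Y Z) (@sV2 U V W X Y Z) (@sW2 U V W X Y Z) ->
  2 * R0 + R1 + R2 < minfo P U2W2 YU1W1 + minfo P V2W2 ZV1W1
                 - cminfo P (@sU2 U V W X Y Z) (@sV2 U V W X Y Z) (@sW2 U V W X Y Z) ->
  achievable q R0 R1 R2.
Proof.
move=> P YU1W1 ZV1W1 U2W2 V2W2 R00 R10 R20 hA hB h3 h4 h5.
have hP : is_pmf P := joint_pmf hq hr3 hrx.
have [a1 [b1 [a2 [b2 [l1 [l2]]]]]] := rates_splittable R00 R10 R20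
  (cminfo_ge0 hP _ _ _) (cminfo_ge0 hP _ _ _) (cminfo_ge0 hP _ _ _) hA hB h3 h4 h5.
set A := minfo P U2W2 YU1W1; set B := minfo P V2W2 ZV1W1.
set A' := cminfo P _ YU1W1 _; set B' := cminfo P _ ZV1W1 _.
set C := cminfo P _ _ _.
move=> [[a10 b10 a20 b20] [l10 l20] [R1e R2e] hC [s1 s2 sA sB]].
(* A common slack for all strict constraints. In [x1] and [x2] the value 1 stands for a constraint
   that is void because the satellite rate is zero; halving at the end provides the margin
   [2 * d]. *)
have [d [d0 dC dA dB [dA' dB']]] : exists d : R, [/\ 0 < d, C + 2 * d <= l1 + l2,
    R0 + a1 + a2 + b1 + l1 + 2 * d <= A, R0 + a1 + a2 + b2 + l2 + 2 * d <= B &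
    (b1 = 0 \/ b1 + l1 + 2 * d <= A') /\ (b2 = 0 \/ b2 + l2 + 2 * d <= B')].
  pose x1 := if b1 == 0 then 1 else A' - b1 - l1.
  pose x2 := if b2 == 0 then 1 else B' - b2 - l2.
  have x10 : 0 < x1 by rewrite /x1; case: eqP => // n; case: s1 => // ?; lra.
  have x20 : 0 < x2 by rewrite /x2; case: eqP => // n; case: s2 => // ?; lra.
  have [d [_ d0 _]] : exists d : R, [/\ 0 <= d, 0 < d, d <= 1 &
     d < Num.min (Num.min (l1 + l2 - C) (Num.min x1 x2)) (Num.min
        (A - (R0 + a1 + a2 + b1 + l1)) (B - (R0 + a1 + a2 + b2 + l2)))].
    by apply: pick_between => //; rewrite !lt_min x10 x20; lra.
  rewrite !lt_min => /andP[/andP[? /andP[e1 e2]] /andP[? ?]].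
  exists (d / 2); split; try lra.
  by split; [move: e1; rewrite /x1|move: e2; rewrite /x2];
    case: eqP => [->|_] ?; (try by left); right; lra.
have [c [c0 code]] := block_code hq hr3 hrx d0.
pose K := c + c / d + (32 * expR (R0 + a1 + a2 + b1 + l1) / d + 2 * expR (b1 + l1) / d)
  + (32 * expR (R0 + a1 + a2 + b2 + l2) / d + 2 * expR (b2 + l2) / d).
move=> eps eps0.
(* With [n = k.+1] this forces [k] to exceed [K / eps]. *)
exists (Num.trunc (K / eps)).+2 => -[//|k]; rewrite ltnS => hk.
have k0 : (0 < k)%N by apply: leq_trans hk.
have kR : 0 < k%:R :> R by rewrite ltr0n.
have Keps : K / k%:R <= eps.
  rewrite ler_pdivrMr// mulrC -ler_pdivrMr//.
  apply: le_trans (ltW (truncnS_gt _)) _.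
  by rewrite ler_nat.
set k0' := msg_size k.+1 R0; set k1' := msg_size k.+1 R1; set k2' := msg_size k.+1 R2.
have m0 : (0 < k0')%N := msg_size_gt0 _ _.
have m1 : (0 < k1')%N := msg_size_gt0 _ _.
have m2 : (0 < k2')%N := msg_size_gt0 _ _.
pose sz (x : R) := msg_size k.+1 x.
(* A private message becomes a cloud part and a satellite part. Rounding may leave spare index
   pairs, so [f1] is only injective. *)
have [f1 [g1 fg1]] : exists (f : 'I_k1' -> 'I_(sz a1) * 'I_(sz b1)) g, cancel f g.
  apply: (split_index (Ordinal m1)).
  by rewrite card_prod !card_ord /k1' R1e msg_size_add.
have [f2 [g2 fg2]] : exists (f : 'I_k2' -> 'I_(sz a2) * 'I_(sz b2)) g, cancel f g.
  apply: (split_index (Ordinal m2)).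
  by rewrite card_prod !card_ord /k2' R2e msg_size_add.
pose T : finType := ('I_k0' * 'I_k1' * 'I_k2')%type.
pose M : finType := ('I_k0' * 'I_(sz a1) * 'I_(sz a2))%type.
(* The cloud index carries the common message and the cloud parts of both private messages. *)
pose mm (t : T) : M := (t.1.1, (f1 t.1.2).1, (f2 t.2).1).
have [||enc [d1 [d2]]] := code k M 'I_(sz b1) 'I_(sz l1) 'I_(sz b2) 'I_(sz l2) T
  (Ordinal m0, Ordinal m1, Ordinal m2) mm
  (fun t => (f1 t.1.2).2) (fun t => (f2 t.2).2) k0; try by rewrite card_ord msg_size_gt0.
set e := (X in _ * (1 - X) <= _); set G := (X in _ <= X) => H.
(* Each receiver recovers the whole cloud index and discards the part meant for the other one. *)
exists enc, (fun y => ((d1 y).1.1.1, g1 ((d1 y).1.1.2, (d1 y).2))),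
  (fun z => ((d2 z).1.1.1, g2 ((d2 z).1.2, (d2 z).2))).
have cT : #|T|%:R = (k0' * k1' * k2')%N%:R :> R by rewrite !card_prod !card_ord.
have N0 : 0 < (k0' * k1' * k2')%N%:R :> R by rewrite ltr0n !muln_gt0 m0 m1.
have eK : e <= K / k%:R.
  have r1 := receiver_term_le k0 d0 R00 a10 a20 b10 l10 dA dA'.
  have r2 := receiver_term_le k0 d0 R00 a10 a20 b20 l20 dB dB'.
  (* The number of satellite pairs outgrows the encoder cutoff because [C + 2 * d <= l1 + l2]. *)
  have rC : c * expR (k%:R * (C + d)) / (sz l1 * sz l2)%N%:R <= c / d / k%:R.
    rewrite -!mulrA ler_wpM2l//.
    apply: (@le_trans _ _ (expR (k%:R * (C + d)) * (expR (k%:R * (l1 + l2)))^-1)).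
      rewrite ler_wpM2l ?expR_ge0// lef_pV2 ?posrE ?expR_gt0//; last first.
        by rewrite ltr0n muln_gt0 !msg_size_gt0.
      rewrite natrM; apply: (@le_trans _ _ (expR (k.+1%:R * l1) * expR (k.+1%:R * l2))).
        by rewrite -expRD ler_expR -natr1; nra.
      by apply: ler_pM; rewrite ?expR_ge0 ?msg_size_ge.
    rewrite -expRN -expRD.
    apply: (@le_trans _ _ (expR (- (k%:R * d)))); first by rewrite ler_expR; nra.
    rewrite expRN -invfM lef_pV2 ?posrE ?expR_gt0 ?mulr_gt0// mulrC.
    by have := expR_ge1Dx (k%:R * d); lra.
  have {}rC : c * expR (k%:R * (C + d)) / (#|'I_(sz l1)| * #|'I_(sz l2)|)%N%:R <= c / d / k%:R.
    by rewrite !card_ord.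
  have -> : K / k%:R = c / k%:R + c / d / k%:R +
    (32 * expR (R0 + a1 + a2 + b1 + l1) / d + 2 * expR (b1 + l1) / d) / k%:R +
    (32 * expR (R0 + a1 + a2 + b2 + l2) / d + 2 * expR (b2 + l2) / d) / k%:R.
    by rewrite /K !mulrDl.
  rewrite /e; apply: lerD; [apply: lerD; [exact: lerD|]|].
    by rewrite !card_prod !card_ord.
  by rewrite !card_prod !card_ord.
apply: le_trans Keps; apply: le_trans eK.
rewrite /avg_err mulrC ler_pdivrMr// -[e * _]mulrC.
(* Correct indices imply correct messages, as [g1] and [g2] invert the splittings. The converse can
   fail, for instance when only the discarded cloud part is wrong, hence an inequality. *)
have GN : G + \sum_(m : 'I_k0' * 'I_k1' * 'I_k2') \sum_(y : {ffun 'I_k.+1 -> Y})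
   \sum_(z : {ffun 'I_k.+1 -> Z}) (\prod_(i < k.+1) q (enc m i) (y i) (z i)) *
   (((((d1 y).1.1.1, g1 ((d1 y).1.1.2, (d1 y).2)) != (m.1.1, m.1.2)) ||
     (((d2 z).1.1.1, g2 ((d2 z).1.2, (d2 z).2)) != (m.1.1, m.2)))%:R) <= #|T|%:R.
  rewrite /G -big_split /= -sumr_const; apply: ler_sum => t _.
  rewrite -[leRHS](proj2 (Qn_channel hq (enc t))) sum_pair /= -big_split /=.
  apply: ler_sum => y _; rewrite -big_split /=; apply: ler_sum => z _.
  rewrite /Qn -mulrDr -[leRHS]mulr1.
  apply: ler_wpM2l.
    by apply: prodr_ge0 => i _; apply: q_ge0.
  have [e1|n1] := eqVneq (d1 y) _; have [e2|n2] := eqVneq (d2 z) _;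
    rewrite ?mul0r ?mulr0 ?add0r ?lern1 ?leq_b1//.
  by rewrite e1 e2 /= -!surjective_pairing fg1 fg2 -surjective_pairing !eqxx mulr1 addr0.
rewrite -cT; rewrite -/G in H; move: GN H; rewrite cT.
set E := (X in G + X); rewrite /E; lra.
Qed.
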